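(* Let $\phi:\mathcal Y(J_{121})\to\mathrm{Frac}\,\mathcal W(A_2)$ and $\phi':\mathcal Y(J_{212})\to\mathrm{Frac}\,\mathcal W(A_2)$ be given on generators by $$\phi:\ Y_1\mapsto\kappa_2^{-1}e^{p_2-u_2-p_1},\ Y_2\mapsto\kappa_2e^{p_2+u_2-p_3},\ Y_3\mapsto\kappa_1^{-1}e^{p_1-u_1},\ Y_4\mapsto\kappa_1\kappa_3^{-1}e^{p_1+u_1+p_3-u_3-p_2},\ Y_5\mapsto\kappa_3e^{p_3+u_3},$$ $$\phi':\ Y_1'\mapsto\kappa_3^{-1}e^{p_3-u_3},\ Y_2'\mapsto\kappa_1e^{p_1+u_1},\ Y_3'\mapsto\kappa_2^{-1}e^{p_2-u_2-p_3},\ Y_4'\mapsto\kappa_1^{-1}\kappa_3e^{p_3+u_3+p_1-u_1-p_2},\ Y_5'\mapsto\kappa_2e^{p_2+u_2-p_1},$$ and let $\pi_{123}$ be the automorphism of $\mathcal W(A_2)$ (and of $\mathrm{Frac}\,\mathcal W(A_2)$) given, in the sense of exponentials, by $$p_1\mapsto p_1+\lambda_{23},\quad p_2\mapsto p_1+p_3,\quad p_3\mapsto p_2-p_1-\lambda_{23},\quad u_1\mapsto u_1+u_2-u_3,\quad u_2\mapsto u_3,\quad u_3\mapsto u_2.$$ (i) $\phi$ and $\phi'$ are morphisms of skew fields. Moreover $$\pi_{123}\circ\phi'=\phi\circ\tau_{4,+}$$ as maps $\mathcal Y(J_{212})\to\mathrm{Frac}\,\mathcal W(A_2)$, where $\tau_{4,+}:\mathcal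 Y(J_{212})\to\mathcal Y(J_{121})$ is the isomorphism $$(Y_1',Y_2',Y_3',Y_4',Y_5')\mapsto(Y_1,\ q^{-1}Y_2Y_4,\ q^{-1}Y_3Y_4,\ Y_4^{-1},\ Y_5).$$ (ii) $\pi_{123}$ is realized as the adjoint action $\mathrm{Ad}(P_{123})$, $x\mapsto P_{123}xP_{123}^{-1}$, of $$P_{123}=\rho_{23}\,e^{\frac1\hbar p_1(u_3-u_2)}\,e^{\frac{\lambda_{23}}\hbar(u_3-u_1)},$$ where $\rho_{23}\in\mathfrak S_3$ is the permutation of the indices $2$ and $3$ of the generators of $\mathcal W(A_2)$ (not acting on indices of the parameters $\lambda_i,\kappa_i$).
   Context: $\hbar$ is a generic complex parameter, $q=e^\hbar$; $\lambda_1,\lambda_2,\lambda_3\in\mathbb C$, $\kappa_j=e^{\lambda_j}$, $\lambda_{jk}=\lambda_j-\lambda_k$. For a skew-symmetric matrix $B=(b_{ij})$ with entries in $\frac12\mathbb Z$, $\mathcal Y(B)$ is the skew field generated by $Y_i$ with relations $Y_iY_j=q^{2b_{ij}}Y_jY_i$. A quiver gives such a $B$: a solid arrow $i\to j$ contributes $b_{ij}=-b_{ji}=1$, a dashed arrow $i\dashrightarrow j$ contributes $b_{ij}=-b_{ji}=\frac12$. The Fock–Goncharov quivers on $\{1,\dots,5\}$ are $J_{121}$: $1\to2$, $2\to4$, $3\to4$, $4\to1$, $4\to5$, $1\dashrightarrow3$, $5\dashrightarrow2$; $J_{212}$: $1\to4$, $4\to2$, $4\to3$, $3\to5$, $5\to4$,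 $3\dashrightarrow1$, $2\dashrightarrow5$. $Y_i$ and $Y_i'$ denote the generators of $\mathcal Y(J_{121})$ and $\mathcal Y(J_{212})$. $p_i,u_i$ ($i=1,2,3$) satisfy $[p_i,u_j]=\hbar\delta_{ij}$, $[p_i,p_j]=[u_i,u_j]=0$. $\mathcal W(A_2)$ is the $\mathbb C$-algebra generated by $e^{\pm p_i},e^{\pm u_i}$ with $e^{p_i}e^{u_j}=q^{\delta_{ij}}e^{u_j}e^{p_i}$ (other pairs commute), and $\mathrm{Frac}\,\mathcal W(A_2)$ is its skew field of fractions. Exponentials of linear combinations are understood by the Baker–Campbell–Hausdorff (BCH) formula $e^Ae^B=e^{[A,B]/2}e^{A+B}$ ($[A,B]$ central). ''In the sense of exponentials'' means $e^{p_i}\mapsto e^{\text{image of }p_i}$, etc. The factors of $P_{123}$ are formal exponentials, acting by conjugation as computed from the commutators via the BCH formula. *)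

(* Defs.v *)
From HB Require Import structures.
From mathcomp Require Import all_boot all_order all_fingroup all_algebra.
From mathcomp Require Import complex.
From mathcomp Require Import reals sequences exp trigo.
From mathcomp Require Import ring.

Set Implicit Arguments.
Unset Strict Implicit.
Unset Printing Implicit Defensive.

Import Order.TTheory GRing.Theory Num.Theory.

Local Open Scope ring_scope.

(* The complex numbers are R[i] for R : realType. *)
Definition expC (R : realType) (z : R[i]) : R[i] :=
  let: Complex x y := z in Complex (expR x * cos y) (expR x * sin y).

(* q^r = e^{r hbar}, for rational exponents r. *)
Definition qpow (R : realType) (hbar : R[i]) (r : rat) : R[i] :=
  expC (ratr r * hbar).

Definition i1 : 'I_3 := @Ordinal 3 0 isT.
Definition i2 : 'I_3 := @Ordinal 3 1 isT.
Definition i3 : 'I_3 := @Ordinal 3 2 isT.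

(* f is the unique algebra morphism with f (x i) = v i. *)
Definition morphism_given_by (K : fieldType) (A B : algType K) (I : Type)
    (x : I -> A) (v : I -> B) (f : {lrmorphism A -> B}) : Prop :=
  (forall i, f (x i) = v i) /\
  (forall g : {lrmorphism A -> B}, (forall i, g (x i) = v i) -> g =1 f).

Definition qcomm_relations (K : fieldType) (A : algType K) (I : Type)
    (c : I -> I -> K) (x xinv : I -> A) : Prop :=
  (forall i, x i * xinv i = 1 /\ xinv i * x i = 1) /\
  (forall i j, x i * x j = c i j *: (x j * x i)).

(* T is the algebra presented by the generators (x i)^{+-1} and the relations
   x i * x j = c i j * (x j * x i); hence T and x are determined up to a unique
   isomorphism. *)
Definition qcomm_presented (K : fieldType) (T : unitAlgType K) (I : Type)
    (c : I -> I -> K) (x : I -> T) : Prop :=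
  qcomm_relations c x (fun i => (x i)^-1) /\
  (forall (A : algType K) (a ainv : I -> A), qcomm_relations c a ainv ->
     exists f : {lrmorphism T -> A}, morphism_given_by x a f).

Definition skew_field (K : fieldType) (F : unitAlgType K) : Prop :=
  forall z : F, z != 0 -> z \is a GRing.unit.

(* F is the skew field of (Ore) fractions of T, via emb. *)
Definition skew_field_of_fractions (K : fieldType) (T F : unitAlgType K)
    (emb : {lrmorphism T -> F}) : Prop :=
  [/\ skew_field F, injective emb
    & forall z : F, exists a b : T, b != 0 /\ z = emb a / emb b].

(* B is skew-symmetric, with entries in (1/2)Z *)
Definition half_integral_skew (n : nat) (B : 'M[rat]_n) : Prop :=
  B^T = - B /\ (forall i j, exists z : int, B i j = z%:~R / 2).

(* F, with generators y, is the skew field Y(B). *)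
Definition is_skew_field_Y (R : realType) (hbar : R[i]) (n : nat)
    (B : 'M[rat]_n) (F : unitAlgType R[i]) (y : 'I_n -> F) : Prop :=
  half_integral_skew B /\
  exists (T : unitAlgType R[i]) (x : 'I_n -> T) (emb : {lrmorphism T -> F}),
    [/\ qcomm_presented (fun i j => qpow hbar (2 * B i j)) x,
        skew_field_of_fractions emb
      & forall i, y i = emb (x i)].

(* Arrows are given by the usual labels 1, ..., n of the vertices; the label of
   i : 'I_n is i.+1. *)
Record quiver := Quiver { solid : seq (nat * nat); dashed : seq (nat * nat) }.

Definition signed_count (s : seq (nat * nat)) (n : nat) (i j : 'I_n) : rat :=
  (count_mem (i.+1, j.+1) s)%:R - (count_mem (j.+1, i.+1) s)%:R.

Definition quiver_matrix (n : nat) (Q : quiver) : 'M[rat]_n :=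
  \matrix_(i, j) (signed_count (solid Q) i j + signed_count (dashed Q) i j / 2).

Definition J121 : quiver := Quiver
  [:: (1, 2); (2, 4); (3, 4); (4, 1); (4, 5)]%N [:: (1, 3); (5, 2)]%N.

Definition J212 : quiver := Quiver
  [:: (1, 4); (4, 2); (4, 3); (3, 5); (5, 4)]%N [:: (3, 1); (2, 5)]%N.

Definition WA2_gens (A : Type) (ep eu : 'I_3 -> A) (k : 'I_3 + 'I_3) : A :=
  match k with inl i => ep i | inr i => eu i end.

Definition WA2_coef (R : realType) (hbar : R[i]) (k l : 'I_3 + 'I_3) : R[i] :=
  match k, l with
  | inl i, inr j => qpow hbar (i == j)%:R
  | inr j, inl i => qpow hbar (- (i == j)%:R)
  | _, _ => 1
  end.

(* W is W(A_2), with ep i = e^{p_i} and eu i = e^{u_i}. *)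
Definition is_WA2 (R : realType) (hbar : R[i]) (W : unitAlgType R[i])
    (ep eu : 'I_3 -> W) : Prop :=
  qcomm_presented (WA2_coef hbar) (WA2_gens ep eu).

(* The triple (c, a, b) encodes the form
   c + \sum_i a_i p_i + \sum_i b_i u_i. *)
Definition linform (R : realType) := (R[i] * ('rV[int]_3 * 'rV[int]_3))%type.

Definition cst (R : realType) (c : R[i]) : linform R := (c, (0, 0)).
Definition P (R : realType) (i : 'I_3) : linform R := (0, (delta_mx 0 i, 0)).
Definition U (R : realType) (i : 'I_3) : linform R := (0, (0, delta_mx 0 i)).
Arguments P {R} i.
Arguments U {R} i.

(* The commutator of two linear forms, from [p_i, u_j] = hbar delta_ij. *)
Definition lin_bracket (R : realType) (hbar : R[i]) (l m : linform R) : R[i] :=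
  hbar * (\sum_i (l.2.1 0 i * m.2.2 0 i - l.2.2 0 i * m.2.1 0 i))%:~R.

(* The exponential of c + a.p + b.u: by the BCH formula
   e^{a.p} e^{b.u} = e^{[a.p, b.u]/2} e^{a.p + b.u} with [a.p, b.u] = hbar a.b.
   See [lin_exp_BCH]. *)
Definition lin_exp (R : realType) (hbar : R[i]) (A : unitAlgType R[i])
    (ep eu : 'I_3 -> A) (l : linform R) : A :=
  let: (c, (a, b)) := l in
  (expC c * expC (- (hbar * (\sum_i a 0 i * b 0 i)%:~R) / 2)) *:
    ((\prod_i ep i ^ a 0 i) * (\prod_i eu i ^ b 0 i)).

Definition kappa (R : realType) (lam : 'I_3 -> R[i]) (j : 'I_3) : R[i] :=
  expC (lam j).

Definition phi_gens (R : realType) (hbar : R[i]) (lam : 'I_3 -> R[i])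
    (A : unitAlgType R[i]) (ep eu : 'I_3 -> A) : 'I_5 -> A :=
  let k := kappa lam in
  let e := lin_exp hbar ep eu in
  tnth [tuple (k i2)^-1 *: e (P i2 - U i2 - P i1);
              k i2 *: e (P i2 + U i2 - P i3);
              (k i1)^-1 *: e (P i1 - U i1);
              (k i1 * (k i3)^-1) *: e (P i1 + U i1 + P i3 - U i3 - P i2);
              k i3 *: e (P i3 + U i3)].

Definition phi'_gens (R : realType) (hbar : R[i]) (lam : 'I_3 -> R[i])
    (A : unitAlgType R[i]) (ep eu : 'I_3 -> A) : 'I_5 -> A :=
  let k := kappa lam in
  let e := lin_exp hbar ep eu in
  tnth [tuple (k i3)^-1 *: e (P i3 - U i3);
              k i1 *: e (P i1 + U i1);
              (k i2)^-1 *: e (P i2 - U i2 - P i3);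
              ((k i1)^-1 * k i3) *: e (P i3 + U i3 + P i1 - U i1 - P i2);
              k i2 *: e (P i2 + U i2 - P i1)].

Definition tau_gens (R : realType) (hbar : R[i]) (A : unitAlgType R[i])
    (y : 'I_5 -> A) : 'I_5 -> A :=
  let Y (k : nat) := y (inord k.-1) in
  let q := expC hbar in
  tnth [tuple Y 1%N; q^-1 *: (Y 2 * Y 4); q^-1 *: (Y 3 * Y 4);
              (Y 4)^-1; Y 5].

Definition pi_p (R : realType) (lam : 'I_3 -> R[i]) : 'I_3 -> linform R :=
  let lam23 := lam i2 - lam i3 in
  tnth [tuple P i1 + cst lam23; P i1 + P i3; P i2 - P i1 - cst lam23].

Definition pi_u (R : realType) : 'I_3 -> linform R :=
  tnth [tuple U i1 + U i2 - U i3; U i3; U i2].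

Definition pi_gens (R : realType) (hbar : R[i]) (lam : 'I_3 -> R[i])
    (A : unitAlgType R[i]) (ep eu : 'I_3 -> A) : 'I_3 + 'I_3 -> A :=
  WA2_gens (fun i => lin_exp hbar ep eu (pi_p lam i))
           (fun i => lin_exp hbar ep eu (pi_u R i)).

Definition lie (A : nzRingType) (x y : A) : A := x * y - y * x.

Definition canonical_relations (K : fieldType) (hbar : K) (H : algType K)
    (p u : 'I_3 -> H) : Prop :=
  forall i j, [/\ lie (p i) (u j) = (hbar *+ (i == j))%:A,
                  lie (p i) (p j) = 0 & lie (u i) (u j) = 0].

Definition lin_val (R : realType) (H : algType R[i]) (p u : 'I_3 -> H)
    (l : linform R) : H :=
  let: (c, (a, b)) := l in
  c%:A + \sum_i p i *~ a 0 i + \sum_i u i *~ b 0 i.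

(* e^X y e^{-X} = e^{ad X} y = z, when ad X is nilpotent on y. *)
Definition exp_ad (K : fieldType) (H : algType K) (X y z : H) : Prop :=
  exists n : nat, iter n (lie X) y = 0 /\
    z = \sum_(k < n) (k`!%:R)^-1 *: iter k (lie X) y.

(* Formal products of permutations of the indices and formal exponentials. *)
Inductive factor (H : Type) := Perm of 'S_3 | Exp of H.
Arguments Perm {H} _.
Arguments Exp {H} _.

(* For l a linear form, e^X e^l e^{-X} = e^{l'} where l' = e^{ad X} l. *)
Definition is_Ad_factor (R : realType) (hbar : R[i]) (H : algType R[i])
    (p u : 'I_3 -> H) (A : unitAlgType R[i]) (ep eu : 'I_3 -> A)
    (x : factor H) (f : A -> A) : Prop :=
  match x with
  | Perm s => forall i, f (ep i) = ep (s i) /\ f (eu i) = eu (s i)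
  | Exp X => forall l : linform R, exists l' : linform R,
      exp_ad X (lin_val p u l) (lin_val p u l') /\
      f (lin_exp hbar ep eu l) = lin_exp hbar ep eu l'
  end.

(* f is the adjoint action y |-> x y x^{-1} of the product x of the factors xs
   on A. *)
Fixpoint is_Ad (R : realType) (hbar : R[i]) (H : algType R[i])
    (p u : 'I_3 -> H) (A : unitAlgType R[i]) (ep eu : 'I_3 -> A)
    (xs : seq (factor H)) (f : A -> A) : Prop :=
  match xs with
  | [::] => f =1 id
  | x :: xs' => exists g h : {lrmorphism A -> A},
      [/\ bijective g, is_Ad_factor hbar p u ep eu x g,
          is_Ad hbar p u ep eu xs' h & f =1 g \o h]
  end.

Definition P123 (R : realType) (hbar : R[i]) (lam : 'I_3 -> R[i])
    (H : algType R[i]) (p u : 'I_3 -> H) : seq (factor H) :=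
  [:: Perm (tperm i2 i3);
      Exp (hbar^-1 *: (p i1 * (u i3 - u i2)));
      Exp (((lam i2 - lam i3) / hbar) *: (u i3 - u i1))].

Lemma expC0 (R : realType) : expC (0 : R[i]) = 1.
Proof. by rewrite /expC /= expR0 cos0 sin0 mulr1 mulr0. Qed.

Lemma expCD (R : realType) (z w : R[i]) : expC (z + w) = expC z * expC w.
Proof.
case: z w => [a b] [c d]; rewrite /expC /= expRD cosD sinD.
by apply/eqP; rewrite eq_complex /=; apply/andP; split; apply/eqP; ring.
Qed.

Lemma expC_neq0 (R : realType) (z : R[i]) : expC z != 0.
Proof.
apply/eqP => z0; have := expCD z (- z).
by rewrite subrr expC0 z0 mul0r => /eqP; rewrite oner_eq0.
Qed.

Lemma expCN (R : realType) (z : R[i]) : expC (- z) = (expC z)^-1.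
Proof.
by apply: (mulfI (expC_neq0 z)); rewrite -expCD subrr expC0 divff ?expC_neq0.
Qed.

Lemma expCMz (R : realType) (z : R[i]) (n : int) :
  expC (z * n%:~R) = expC z ^ n.
Proof.
have nat_case (m : nat) : expC (z * m%:R) = expC z ^+ m.
  elim: m => [|m IHm]; first by rewrite mulr0 expC0.
  by rewrite -natr1 mulrDr mulr1 expCD IHm exprSr.
case: n => m; first exact: nat_case.
by rewrite NegzE mulrNz mulrN expCN nat_case exprnN.
Qed.

Lemma quiver_matrix_half_integral_skew (n : nat) (Q : quiver) :
  half_integral_skew (quiver_matrix n Q).
Proof.
split; first by apply/matrixP => i j; rewrite !mxE /signed_count; ring.
move=> i j; rewrite !mxE /signed_count.
pose c (k l : nat) (s : seq (nat * nat)) : int := (count_mem (k, l) s)%:Z.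
exists (2 * (c i.+1 j.+1 (solid Q) - c j.+1 i.+1 (solid Q))
        + (c i.+1 j.+1 (dashed Q) - c j.+1 i.+1 (dashed Q))).
by rewrite !(intrD, intrM, intrN, intrB) /c -!pmulrn; field.
Qed.

Section QComm.
Variables (K : fieldType) (A : unitAlgType K).
Implicit Types (x y z : A) (k l : K).

Let qc k x y := x * y = k *: (y * x).

Let qc_sym k x y : k != 0 -> qc k x y -> qc k^-1 y x.
Proof. by move=> k0 e; rewrite /qc e scalerA mulVf ?scale1r. Qed.

Let qcMl k l x y z : qc k x z -> qc l y z -> qc (k * l) (x * y) z.
Proof.
move=> e f; rewrite /qc -mulrA f -scalerAr [x * (z * y)]mulrA e -scalerAl.
by rewrite scalerA mulrC !mulrA.
Qed.

Let qc1l z : qc 1 1 z.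
Proof. by rewrite /qc mul1r mulr1 scale1r. Qed.

Let qcXl k x y (n : nat) : qc k x y -> qc (k ^+ n) (x ^+ n) y.
Proof.
by move=> e; elim: n => [|n IHn]; rewrite ?exprS; [exact: qc1l | exact: qcMl].
Qed.

Let qcVl k x y : k != 0 -> x \is a GRing.unit -> qc k x y -> qc k^-1 x^-1 y.
Proof.
move=> k0 ux e; rewrite /qc; apply: (mulrI ux); apply: (mulIr ux).
rewrite mulrA mulrV // mul1r -scalerAr -scalerAl mulrA -!mulrA mulVr // mulr1.
by rewrite e scalerA mulVf // scale1r.
Qed.

Let qczl k x y (n : int) :
  k != 0 -> x \is a GRing.unit -> qc k x y -> qc (k ^ n) (x ^ n) y.
Proof.
move=> k0 ux e; case: n => n; first exact: qcXl.
by rewrite NegzE -!exprz_inv; apply: (@qcXl _ _ _ n.+1); apply: qcVl.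
Qed.

Lemma qcomm_exprz k x y (m n : int) : k != 0 ->
  x \is a GRing.unit -> y \is a GRing.unit -> x * y = k *: (y * x) ->
  x ^ m * y ^ n = k ^ (m * n) *: (y ^ n * x ^ m).
Proof.
move=> k0 ux uy e; have km0 : (k ^ m)^-1 != 0 by rewrite invr_eq0 expfz_neq0.
have := qc_sym (expfz_neq0 n km0)
  (qczl n km0 uy (qc_sym (expfz_neq0 m k0) (qczl m k0 ux e))).
by rewrite /qc !invr_expz exprz_exp mulrNN.
Qed.

Lemma qcomm_prod (I : eqType) (r s : seq I) (k : I -> I -> K) (x y : I -> A) :
  (forall i j, k i j != 0) ->
  (forall i j, x i * y j = k i j *: (y j * x i)) ->
  (\prod_(i <- r) x i) * (\prod_(j <- s) y j) =
    (\prod_(i <- r) \prod_(j <- s) k i j) *: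
      ((\prod_(j <- s) y j) * (\prod_(i <- r) x i)).
Proof.
move=> k0 e; elim: r => [|i r IHr]; first by rewrite !big_nil; apply: qc1l.
have p0 : \prod_(j <- s) k i j != 0.
  by rewrite prodf_seq_neq0; apply/allP => j _; apply: k0.
have ps : qc (\prod_(j <- s) k i j)^-1 (\prod_(j <- s) y j) (x i).
  elim: (s) => [|j t IHt]; first by rewrite !big_nil invr1; apply: qc1l.
  by rewrite !big_cons invfM; apply: qcMl => //; apply: qc_sym.
rewrite !big_cons; apply: qcMl => //.
by have := qc_sym (invr_neq0 p0) ps; rewrite invrK.
Qed.

End QComm.

Lemma lin_exp_BCH (R : realType) (hbar : R[i]) (A : unitAlgType R[i])
    (ep eu : 'I_3 -> A) (l m : linform R) :
  qcomm_relations (WA2_coef hbar) (WA2_gens ep eu)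
    (fun k => (WA2_gens ep eu k)^-1) ->
  lin_exp hbar ep eu l * lin_exp hbar ep eu m =
    expC (lin_bracket hbar l m / 2) *: lin_exp hbar ep eu (l + m).
Proof.
case: l m => [c [a b]] [c' [a' b']] [inv rel].
have unitg k : WA2_gens ep eu k \is a GRing.unit.
  by apply/unitrP; exists (WA2_gens ep eu k)^-1; have [] := inv k.
have up i : ep i \is a GRing.unit by exact: (unitg (inl i)).
have uu i : eu i \is a GRing.unit by exact: (unitg (inr i)).
have prodD (g : 'I_3 -> A) (v w : 'rV[int]_3) :
    (forall i, g i \is a GRing.unit) -> (forall i j, g i * g j = g j * g i) ->
  \prod_i g i ^ (v + w) 0 i = (\prod_i g i ^ v 0 i) * (\prod_i g i ^ w 0 i).
  move=> ug cg; have cz i j d e : GRing.comm (g i ^ d) (g j ^ e).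
    rewrite /GRing.comm (@qcomm_exprz _ _ 1 _ _ d e (oner_neq0 _)) //.
      by rewrite exp1rz scale1r.
    by rewrite scale1r.
  have cp i d r : GRing.comm (g i ^ d) (\prod_(j <- r) g j ^ v 0 j).
    by apply: commr_prod => j _; apply: cz.
  elim: (index_enum _) => [|i r IHr]; first by rewrite !big_nil mulr1.
  rewrite !big_cons IHr mxE exprzDr // -!mulrA; congr (_ * _).
  by rewrite !mulrA; congr (_ * _); apply: cp.
have epC i j : ep i * ep j = ep j * ep i.
  by have := rel (inl i) (inl j); rewrite /= scale1r.
have euC i j : eu i * eu j = eu j * eu i.
  by have := rel (inr i) (inr j); rewrite /= scale1r.
pose d (i j : 'I_3) : R[i] := expC (- hbar * (i == j)%:R).
have upC i j : eu i * ep j = d i j *: (ep j * eu i).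
  have := rel (inr i) (inl j); rewrite /= /qpow eq_sym => ->.
  by rewrite raddfN /= ratr_nat /d; congr (expC _ *: _); ring.
pose k i j := d i j ^ (b 0 i * a' 0 j).
have k0 i j : k i j != 0 by rewrite expfz_neq0 ?expC_neq0.
have swap : (\prod_i eu i ^ b 0 i) * (\prod_j ep j ^ a' 0 j) =
    expC (- hbar * (\sum_i b 0 i * a' 0 i)%:~R) *:
      ((\prod_j ep j ^ a' 0 j) * (\prod_i eu i ^ b 0 i)).
  rewrite (@qcomm_prod _ _ _ _ _ k) // => [|i j]; last first.
    by apply: qcomm_exprz => //; apply: expC_neq0.
  congr (_ *: _); rewrite (raddf_sum (intmul 1)) /= mulr_sumr.
  rewrite (big_morph _ (@expCD R) (expC0 R)); apply: eq_bigr => i _.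
  rewrite (bigD1 i) //= big1 ?mulr1 => [|j ji].
    by rewrite /k /d eqxx mulr1 expCMz.
  by rewrite /k /d eq_sym (negPf ji) mulr0 expC0 exp1rz.
rewrite /lin_exp /lin_bracket /= !prodD // -scalerAl -scalerAr !scalerA.
rewrite -!mulrA [(\prod_i eu i ^ b 0 i) * (_ * _)]mulrA swap.
rewrite -scalerAl -!scalerAr scalerA.
rewrite !mulrA -!expCD; congr (expC _ *: _).
rewrite !big_ord_recl !big_ord0 !mxE !(intrD, intrM, intrN, intrB).
by field.
Qed.

(* Main.v *)
(* Distinct monomials of a quantum torus have distinct q-commutation factors with
   suitable units, so for q not a root of unity they stay linearly independent
   under any morphism that keeps enough of these factors.  Hence phi, phi' and tau
   are injective on the quantum tori and extend to the skew fields of fractions.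
   On exponentials of linear forms, everything reduces to linear algebra: by BCH,
   a map of linear forms which preserves the bracket induces an automorphism of
   W(A_2).  The factors of P_123 act by such maps, a permutation and two
   unipotent maps, whose composite is pi_123.  The relations satisfied by tau are
   read off in Frac W(A_2), through the injective phi, on phi tau = pi phi'. *)
From HB Require Import structures.
From mathcomp Require Import all_boot all_order all_fingroup all_algebra.
From mathcomp Require Import complex boolp.
From mathcomp Require Import reals sequences exp trigo.
From mathcomp Require Import ring lra.
Require Import Defs.

Set Implicit Arguments.
Unset Strict Implicit.
Unset Printing Implicit Defensive.

Import Order.TTheory GRing.Theory Num.Theory.

Local Open Scope ring_scope.

Arguments expC : simpl never.
Arguments lin_exp : simpl never.

(** A morphism from a quantum torus to a skew field extends to fractions only if no nonzero element
    is sent to 0, so injectivity is the real obstacle. The torus is known only through its universal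
    property: no basis of monomials is given, so spanning is proved by induction and independence is
    tested in the target. Conjugation by the [Y_i] alone could not do this. A skew-symmetric matrix
    of size 5 is singular, so some nontrivial monomial in the [Y_i] is central and cannot be told
    apart from 1. The six exponentials [e^{p_i}], [e^{u_i}] do separate the monomials, because the
    bracket on the span of the [p_i] and [u_i] is nondegenerate and the five exponents are linearly
    independent. These units live in Frac W(A_2) and not in the target of tau, which is why tau is
    studied through phi. *)

Lemma lrmorphism_exists (K : fieldType) (A B : algType K) (g : A -> B) :
    (forall a u v, g (a *: u + v) = a *: g u + g v) -> g 1 = 1 ->
    (forall u v, g (u * v) = g u * g v) ->
  exists h : {lrmorphism A -> B}, h =1 g.
Proof.
move=> gP g1 gM.
pose gL := GRing.isLinear.Build K A B *:%R g gP.
pose gR := GRing.isMonoidMorphism.Build A B g (g1, gM).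
by pose h : {lrmorphism A -> B} := HB.pack g gL gR; exists h.
Qed.

(** * Presented algebras and monomials *)

Section Subalgebra.
Variables (K : fieldType) (T : algType K) (S : subalgClosed T).

(** The universal property of a presented algebra quantifies over [algType], so a subalgebra has to
    be a type of its own before it can serve as a target. *)
Definition subalgebra := {t : T | t \in S}.
HB.instance Definition _ := [isSub of subalgebra for sval].
HB.instance Definition _ := [Choice of subalgebra by <:].
HB.instance Definition _ := [SubChoice_isSubAlgebra of subalgebra by <:].
End Subalgebra.

Section Presented.
Variables (K : fieldType) (T : unitAlgType K) (I : Type).
Variables (c : I -> I -> K) (x : I -> T).
Hypothesis presT : qcomm_presented c x.

(** Both morphisms equal the one that the universal property attaches to the images of the
    generators. Since [A] has no inverse operation, the inverses of these images are taken to be the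
    images of the inverses. *)
Lemma presented_eq (A : algType K) (g h : {lrmorphism T -> A}) :
  (forall i, g (x i) = h (x i)) -> g =1 h.
Proof.
move=> gh; have [[xV xC] /(_ A (g \o x) (fun i => g (x i)^-1))] := presT.
case=> [|f [_ uniq_f] t].
  split=> [i | i j] /=; last by rewrite -rmorphM xC /= linearZ rmorphM.
  by have [xVr xVl] := xV i; rewrite -!rmorphM xVr xVl rmorph1.
by rewrite (uniq_f g) // (uniq_f h) // => i; rewrite -gh.
Qed.

Lemma presented_unit i : x i \is a GRing.unit.
Proof. by have [[/(_ i)[xVr xVl] _] _] := presT; apply/unitrP; exists (x i)^-1. Qed.

(* The subalgebra of all t with P t receives a morphism from T, whose composite
   with the inclusion fixes the generators, hence is the identity. *)
Lemma presented_ind (P : T -> Prop) :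
    P 1 -> (forall a t s, P t -> P s -> P (a *: t + s)) ->
    (forall t s, P t -> P s -> P (t * s)) ->
    (forall i, P (x i)) -> (forall i, P (x i)^-1) ->
  forall t, P t.
Proof.
move=> P1 PD PM Px PxV t.
pose S : T -> bool := fun t => `[< P t >].
have SS : subalg_closed S.
  split; first exact/asboolP.
    by move=> a s r /asboolP ? /asboolP ?; apply/asboolP/PD.
  by move=> s r /asboolP ? /asboolP ?; apply/asboolP/PM.
pose SM := GRing.isSubalgClosed.Build K T S (GRing.subalg_closed_semi SS).
pose SC : subalgClosed T := HB.pack S SM.
have xS i : x i \in SC by apply/asboolP.
have xVS i : (x i)^-1 \in SC by apply/asboolP.
pose y i : subalgebra SC := exist _ (x i) (xS i).
pose yV i : subalgebra SC := exist _ (x i)^-1 (xVS i).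
have [[xV xC] /(_ (subalgebra SC) y yV)] := presT.
case=> [|f [fx _]].
  split=> [i | i j]; last exact/val_inj/xC.
  by have [xVr xVl] := xV i; split; apply: val_inj.
have [|||g gE] := @lrmorphism_exists K T T (val \o f).
- by move=> a t1 t2 /=; rewrite linearP.
- by rewrite /= rmorph1.
- by move=> t1 t2 /=; rewrite rmorphM.
have /(_ t) : g =1 (idfun : {lrmorphism T -> T}).
  by apply: presented_eq => i /=; rewrite gE /= fx.
by rewrite /= gE /= => <-; apply/asboolP/(valP (f t)).
Qed.

End Presented.

Section Monomials.
Variables (K : fieldType) (T : unitAlgType K) (I : finType).
Variables (c : I -> I -> K) (x : I -> T).

Definition monomial (v : {ffun I -> int}) : T := \prod_i x i ^ v i.

Hypothesis presT : qcomm_presented c x.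
Hypothesis c_neq0 : forall i j, c i j != 0.

Let ux := presented_unit presT.

Let xzC i j (m n : int) : x i ^ m * x j ^ n = c i j ^ (m * n) *: (x j ^ n * x i ^ m).
Proof. by apply: qcomm_exprz => //; case: presT => -[_ ->]. Qed.

Lemma monomialM (v w : {ffun I -> int}) :
  exists a, monomial v * monomial w = a *: monomial (v + w).
Proof.
rewrite /monomial; elim: (index_enum I) => [|i r [a IHr]].
  by exists 1; rewrite !big_nil scale1r mulr1.
pose d j k := c j k ^ (v j * w k).
(* The first factor is the cost of moving the power of [x i] from the second monomial leftwards past
   the rest of the first one. *)
exists ((\prod_(j <- r) \prod_(k <- [:: i]) d j k) * a).
have := @qcomm_prod K T I r [:: i] d (fun j => x j ^ v j) (fun k => x k ^ w k)
  (fun j k => expfz_neq0 _ (c_neq0 j k)) (fun j k => xzC j k (v j) (w k)).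
rewrite !big_seq1 !big_cons => vw; rewrite -scalerA ffunE exprzDr // -[LHS]mulrA.
rewrite [X in _ * X = _]mulrA vw -!scalerAl -!scalerAr; congr (_ *: _).
by rewrite -!mulrA IHr -!scalerAr.
Qed.

Lemma monomial_single i z : monomial [ffun j => z *+ (i == j)] = x i ^ z.
Proof.
rewrite /monomial (@big_only1 _ _ _ _ i) ?ffunE ?eqxx // => j ji _.
by rewrite ffunE eq_sym (negPf ji).
Qed.

Lemma monomial_span t : exists s : seq (K * {ffun I -> int}),
  t = \sum_(m <- s) m.1 *: monomial m.2.
Proof.
pose P t := exists s : seq (K * {ffun I -> int}),
  t = \sum_(m <- s) m.1 *: monomial m.2.
have P0 : P 0 by exists [::]; rewrite big_nil.
have PD s r : P s -> P r -> P (s + r).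
  by move=> [s1 ->] [s2 ->]; exists (s1 ++ s2); rewrite big_cat.
have PZ a s : P s -> P (a *: s).
  move=> [s1 ->]; exists [seq (a * m.1, m.2) | m <- s1].
  by rewrite big_map scaler_sumr; under [RHS]eq_bigr do rewrite -scalerA.
have Pm v : P (monomial v) by exists [:: (1, v)]; rewrite big_seq1 scale1r.
have Px i z : P (x i ^ z) by rewrite -monomial_single; apply: Pm.
apply: (presented_ind presT (P := P)) => [|a s r Ps Pr|s r [s1 ->] [s2 ->]|i|i].
(* The unit is [x i ^ 0] if there is a generator, and the empty product otherwise. *)
- have [i|I0] := pickP (@predT I); first by have := Px i 0.
  by have := Pm 0; rewrite /monomial big_pred0.
- by apply: (PD _ _ (PZ _ _ Ps)).
- rewrite mulr_suml; apply: big_ind => // m _.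
  rewrite mulr_sumr; apply: big_ind => // n _.
  rewrite -scalerAl -scalerAr; do 2!apply: (PZ).
  by have [a ->] := monomialM m.2 n.2; apply/PZ/Pm.
- exact: (Px i 1).
- exact: (Px i (-1)).
Qed.

End Monomials.

(* Conjugation by E k minus chi k v0 kills the v0 term and separates it from any
   other given term for some k. *)
Lemma eigenvectors_free (K : fieldType) (A : unitAlgType K) (V : eqType) (J : Type)
    (E : J -> A) (m : V -> A) (chi : J -> V -> K) :
    (forall k, E k \is a GRing.unit) -> (forall v, m v \is a GRing.unit) ->
    (forall k v, E k * m v = chi k v *: (m v * E k)) ->
    (forall v w, (forall k, chi k v = chi k w) -> v = w) ->
  forall (s : seq V) (a : V -> K), uniq s -> \sum_(v <- s) a v *: m v = 0 ->
  {in s, forall v, a v = 0}.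
Proof.
move=> uE um Em sep; elim=> [|v0 s IHs] a //= /andP[v0s us] sum0.
have as0 : {in s, forall v, a v = 0}.
  move=> v vs; apply/eqP; apply: contraNT v0s => av0.
  suff -> : v0 = v by [].
  apply: sep => k; apply/esym/eqP; rewrite -subr_eq0.
  suff /(IHs (fun w => a w * (chi k w - chi k v0)) us)/(_ v vs)/eqP :
      \sum_(w <- s) (a w * (chi k w - chi k v0)) *: m w = 0.
    by rewrite mulf_eq0 (negPf av0).
  apply: (mulIr (uE k)); rewrite mul0r mulr_suml.
  rewrite big_cons in sum0.
  (* With [S] the vanishing sum, this is [E k * S - chi k v0 *: (S * E k)]: the [v0] terms cancel
     and every other term acquires the factor [chi k w - chi k v0]. *)
  transitivity (E k * (a v0 *: m v0 + \sum_(w <- s) a w *: m w)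
    - chi k v0 *: ((a v0 *: m v0 + \sum_(w <- s) a w *: m w) * E k)); last first.
    by rewrite sum0 mul0r mulr0 scaler0 subr0.
  rewrite mulrDr mulrDl -!scalerAr -!scalerAl Em scalerDr opprD addrACA.
  rewrite !scalerA [a v0 * _]mulrC subrr add0r.
  rewrite mulr_sumr mulr_suml scaler_sumr -sumrB; apply: eq_bigr => w _.
  rewrite -scalerAl -scalerAr Em -scalerAl !scalerA -scalerBl mulrBr.
  by congr ((_ - _) *: _); rewrite mulrC.
move=> v; rewrite inE => /orP[/eqP -> | /as0 //].
move: sum0; rewrite big_cons big_seq big1 => [|w ws]; last by rewrite as0 ?scale0r.
rewrite addr0 => /(congr1 (fun z => z * (m v0)^-1)); rewrite mul0r -scalerAl mulrV //.
by move/eqP; rewrite scaler_eq0 oner_eq0 orbF => /eqP.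
Qed.

Lemma exprz_eq1_root_free (K : fieldType) (q : K) :
  q != 0 -> (forall n, (0 < n)%N -> q ^+ n != 1) -> forall z : int, q ^ z = 1 -> z = 0.
Proof.
move=> q0 qn [[|n]|n] //; first by move/eqP; rewrite (negPf (qn _ _)).
rewrite NegzE -exprnN => /(canRL (@invrK _)); rewrite invr1 => /eqP.
by rewrite (negPf (qn _ _)).
Qed.

(** Each [E k] acts on the image of the monomial [v] with eigenvalue [q] to the power
    [\sum_i n k i * v i]. As [q] is not a root of unity, equal eigenvalues mean equal exponents, and
    the last hypothesis then forces equal monomials. *)
Lemma torus_morphism_inj (K : fieldType) (T A : unitAlgType K) (I : finType) (J : Type)
    (c : I -> I -> K) (x : I -> T) (f : {lrmorphism T -> A})
    (q : K) (E : J -> A) (n : J -> I -> int) :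
    qcomm_presented c x -> (forall i j, c i j != 0) ->
    q != 0 -> (forall k, (0 < k)%N -> q ^+ k != 1) ->
    (forall k, E k \is a GRing.unit) ->
    (forall k i, E k * f (x i) = q ^ n k i *: (f (x i) * E k)) ->
    (forall v : I -> int, (forall k, \sum_i n k i * v i = 0) -> forall i, v i = 0) ->
  injective f.
Proof.
move=> presT c0 q0 qn uE Ef nker; apply: raddf_inj => t.
have ux := presented_unit presT.
have ufx i : f (x i) \is a GRing.unit by apply: rmorph_unit.
have [s ->] := monomial_span presT c0 t.
(* The list from the spanning lemma may repeat exponents; [a] collects their coefficients so that
   independence applies to distinct monomials. *)
pose w := undup [seq m.2 | m <- s].
pose a v := \sum_(m <- s | m.2 == v) m.1.
have -> : \sum_(m <- s) m.1 *: monomial x m.2 = \sum_(v <- w) a v *: monomial x v.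
  under [RHS]eq_bigr do rewrite scaler_suml.
  rewrite (exchange_big_dep xpredT) //= big_seq [RHS]big_seq.
  apply: eq_bigr => m ms; rewrite (big_rem m.2) /= ?eqxx; last first.
    by rewrite mem_undup map_f.
  rewrite big_seq_cond big1 ?addr0 // => v /andP[].
  by rewrite mem_rem_uniq ?undup_uniq // inE => /andP[/negPf vm _]; rewrite eq_sym vm.
rewrite raddf_sum /= => sum0.
pose chi k (v : {ffun I -> int}) := q ^ (\sum_i n k i * v i).
have fm v : f (monomial x v) = \prod_i f (x i) ^ v i.
  by rewrite rmorph_prod; apply: eq_bigr => i _; rewrite rmorphXz.
have aw0 : {in w, forall v, a v = 0}.
  apply: (@eigenvectors_free K A _ J E (f \o monomial x) chi) => //=.
  - by move=> v; apply/rmorph_unit/rpred_prod => i _; rewrite unitrXz.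
  - move=> k v; rewrite fm /chi; elim: (index_enum I) => [|i r IHr].
      by rewrite !big_nil expr0z scale1r mulr1 mul1r.
    have Efz : E k * f (x i) ^ v i = q ^ (n k i * v i) *: (f (x i) ^ v i * E k).
      have := @qcomm_exprz _ _ _ _ _ 1 (v i) (expfz_neq0 _ q0) (uE k) (ufx i) (Ef k i).
      by rewrite mul1r exprz_exp.
    by rewrite !big_cons mulrA Efz expfzDr // -scalerA -scalerAl -!mulrA IHr -!scalerAr.
  - move=> v v' vv'; apply/ffunP => i; apply/eqP; rewrite -subr_eq0; apply/eqP.
    apply: (nker (fun i => v i - v' i)) => k; apply: (exprz_eq1_root_free q0 qn).
    rewrite (eq_bigr (fun i => n k i * v i - n k i * v' i)) => [|j _]; last exact: mulrBr.
    by rewrite sumrB expfzDr // -/(chi k v) -invr_expz -/(chi k v') vv' mulfV ?expfz_neq0.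
  - exact: undup_uniq.
  - by rewrite -[RHS]sum0; apply: eq_bigr => v _; rewrite linearZ.
by rewrite big_seq big1 // => v /aw0 ->; rewrite scale0r.
Qed.

(** * Skew fields of fractions *)

Lemma skew_field_morphism_inj (K : fieldType) (F A : unitAlgType K)
    (f : {lrmorphism F -> A}) : skew_field F -> injective f.
Proof.
move=> skF; apply: raddf_inj => z fz0; apply/eqP; apply: contraT => /skF uz.
by have := rmorph_unit f uz; rewrite fz0 unitr0.
Qed.

Section Fractions.
Variables (K : fieldType) (T F : unitAlgType K) (emb : {lrmorphism T -> F}).
Hypothesis fracF : skew_field_of_fractions emb.

Let skF : skew_field F. Proof. by case: fracF. Qed.
Let emb_inj : injective emb. Proof. by case: fracF. Qed.

Lemma fractions_eq (A : unitAlgType K) (g h : {lrmorphism F -> A}) :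
  (forall t, g (emb t) = h (emb t)) -> g =1 h.
Proof.
have [_ _ fracE] := fracF => gh z; have [a [b [b0 ->]]] := fracE z.
have ub : emb b \is a GRing.unit by rewrite skF // raddf_eq0.
by rewrite !rmorphM !rmorphV //= !gh.
Qed.

Variables (A : unitAlgType K) (f : {lrmorphism T -> A}).
Hypothesis skA : skew_field A.
Hypothesis f_inj : injective f.

Let emb_unit (t : T) : t != 0 -> emb t \is a GRing.unit.
Proof. by move=> t0; rewrite skF // raddf_eq0. Qed.

Let f_unit (t : T) : t != 0 -> f t \is a GRing.unit.
Proof. by move=> t0; rewrite skA // raddf_eq0. Qed.

Let nz_mul (s t : T) : s != 0 -> t != 0 -> s * t != 0.
Proof.
move=> s0 t0; rewrite -(raddf_eq0 _ emb_inj) /= rmorphM.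
have : emb s * emb t \is a GRing.unit by rewrite unitrMl emb_unit.
by apply: contraTneq => ->; rewrite unitr0.
Qed.

(* The Ore condition, obtained by writing b^-1 d as a right fraction s / t. *)
Let ore (b d : T) : b != 0 -> exists s t, t != 0 /\ b * s = d * t.
Proof.
move=> b0; have [_ _ /(_ ((emb b)^-1 * emb d))[s [t [t0 e]]]] := fracF.
exists s, t; split=> //; apply: emb_inj; rewrite !rmorphM.
apply: (mulrI (x := (emb b)^-1)); first by rewrite unitrV emb_unit.
rewrite mulrA mulVr ?emb_unit // mul1r mulrA e divrK ?emb_unit //.
Qed.

Let common (b d : T) : b != 0 -> d != 0 ->
  exists s t, [/\ s != 0, t != 0 & b * s = d * t].
Proof.
move=> b0 d0; have [s [t [t0 e]]] := ore d b0; exists s, t; split=> //.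
by apply: contraNneq (nz_mul d0 t0) => s0; rewrite -e s0 mulr0.
Qed.

(** The target is arbitrary because fractions are brought to a common denominator both under [emb]
    and under [f]. *)
Let quotM (B : unitAlgType K) (g : {lrmorphism T -> B}) (a b s : T) :
    (forall t, t != 0 -> g t \is a GRing.unit) -> b != 0 -> s != 0 ->
  g (a * s) / g (b * s) = g a / g b.
Proof.
move=> ug b0 s0; apply: (mulIr (ug _ (nz_mul b0 s0))).
by rewrite divrK ?ug ?nz_mul // !rmorphM mulrA divrK ?ug.
Qed.

(** Over the common denominator [b * s = d * t], equal fractions in [F] have equal numerators
    already in [T], and [f] carries this equality to [A]. *)
Let quot_eq (a b c d : T) : b != 0 -> d != 0 ->
  emb a / emb b = emb c / emb d -> f a / f b = f c / f d.
Proof.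
move=> b0 d0; have [s [t [s0 t0 e]]] := common b0 d0.
rewrite -(quotM a emb_unit b0 s0) -(quotM c emb_unit d0 t0) e.
rewrite -(quotM a f_unit b0 s0) -(quotM c f_unit d0 t0) e.
by move=> /mulIr; rewrite unitrV emb_unit ?nz_mul // => /(_ isT)/emb_inj ->.
Qed.

Lemma fractions_lift : exists g : {lrmorphism F -> A}, forall t, g (emb t) = f t.
Proof.
have [_ _ fracE] := fracF.
have [nd ndP] : {nd : F -> T * T &
    forall z, (nd z).2 != 0 /\ z = emb (nd z).1 / emb (nd z).2}.
  apply: (@choice F (T * T)%type (fun z ab => ab.2 != 0 /\ z = emb ab.1 / emb ab.2)).
  by move=> z; have [a [b [b0 e]]] := fracE z; exists (a, b).
pose g z := f (nd z).1 / f (nd z).2.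
have gE a b : b != 0 -> g (emb a / emb b) = f a / f b.
  by move=> b0; have [d0 e] := ndP (emb a / emb b); apply/esym/quot_eq.
have gT t : g (emb t) = f t.
  by have := gE t 1 (oner_neq0 _); rewrite !rmorph1 !divr1.
have [|||h hE] := @lrmorphism_exists K F A g.
- move=> k u v; have [a [b [b0 ->]]] := fracE u; have [c [d [d0 ->]]] := fracE v.
  have [s [t [s0 t0 e]]] := common b0 d0.
  rewrite !gE // -(quotM a emb_unit b0 s0) -(quotM c emb_unit d0 t0).
  rewrite -(quotM a f_unit b0 s0) -(quotM c f_unit d0 t0) e.
  by rewrite !scalerAl -!linearZ -!mulrDl -!raddfD gE ?nz_mul.
- by rewrite -(rmorph1 emb) gT rmorph1.
- move=> u v; have [a [b [b0 ->]]] := fracE u; have [c [d [d0 ->]]] := fracE v.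
  (* From [b * s = c * t], the inner quotient of [c] by [b] on the left is [s] over [t], so the
     product is one fraction. This is computed once for [emb] and once for [f]. *)
  have [s [t [t0 e]]] := ore c b0.
  have mulE (B : unitAlgType K) (k : {lrmorphism T -> B}) :
      (forall t, t != 0 -> k t \is a GRing.unit) ->
    k a / k b * (k c / k d) = k (a * s) / k (d * t).
    move=> uk; apply: (mulIr (uk _ (nz_mul d0 t0))).
    rewrite divrK ?uk ?nz_mul // !rmorphM -!mulrA; congr (_ * _).
    rewrite mulKr ?uk // -rmorphM -e rmorphM mulKr ?uk //.
  by rewrite mulE // !gE ?nz_mul // mulE.
by exists h => t; rewrite hE.
Qed.

End Fractions.

Section SkewFieldY.
Variables (R : realType) (hbar : R[i]) (n : nat) (B : 'M[rat]_n).
Variables (F : unitAlgType R[i]) (y : 'I_n -> F).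
Hypothesis FY : is_skew_field_Y hbar B y.

Let q i j := qpow hbar (2 * B i j).

Lemma skew_field_Y_skew : skew_field F.
Proof. by have [_ [T [x [emb [_ []]]]]] := FY. Qed.

Lemma skew_field_Y_eq (A : unitAlgType R[i]) (g h : {lrmorphism F -> A}) :
  (forall i, g (y i) = h (y i)) -> g =1 h.
Proof.
have [_ [T [x [emb [presT fracF yE]]]]] := FY => gh.
apply: (fractions_eq fracF) => t.
apply: (presented_eq presT (g := g \o emb) (h := h \o emb)) => i /=.
by rewrite -yE.
Qed.

(** Injectivity is requested for every presented torus because the one underlying [F] is hidden by
    an existential. *)
Lemma skew_field_Y_lift (A : unitAlgType R[i]) (v : 'I_n -> A) :
    skew_field A -> qcomm_relations q v (fun i => (v i)^-1) ->
    (forall (T : unitAlgType R[i]) (x : 'I_n -> T) (f : {lrmorphism T -> A}),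
      qcomm_presented q x -> (forall i, f (x i) = v i) -> injective f) ->
  exists g : {lrmorphism F -> A}, morphism_given_by y v g.
Proof.
move=> skA rel inj; have [_ [T [x [emb [presT fracF yE]]]]] := FY.
have [_ /(_ A v _ rel)[f [fx _]]] := presT.
have [g gE] := fractions_lift fracF skA (inj T x f presT fx).
have gy i : g (y i) = v i by rewrite yE gE.
by exists g; split=> // h hy; apply: skew_field_Y_eq => i; rewrite hy gy.
Qed.

(** The range of a morphism out of a skew field is closed under inverses, so containing the
    generators it contains the torus and then all fractions. *)
Lemma skew_field_Y_surj (A : unitAlgType R[i]) (g : {lrmorphism A -> F}) :
    skew_field A -> (forall i, exists z, g z = y i) -> forall w, exists z, g z = w.
Proof.
move=> skA gy; have [_ [T [x [emb [presT [skF emb_inj fracE] yE]]]]] := FY.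
have gV z w : g z = w -> exists z', g z' = w^-1.
  move=> <-; have [->|/skA uz] := eqVneq z 0; last by exists z^-1; rewrite rmorphV.
  by exists 0; rewrite rmorph0 invr0.
have gT : forall t, exists z, g z = emb t.
  apply: (presented_ind presT) => [|a t s [u gu] [v gv]|t s [u gu] [v gv]|i|i].
  - by exists 1; rewrite !rmorph1.
  - by exists (a *: u + v); rewrite [LHS]linearP [RHS]linearP /= gu gv.
  - by exists (u * v); rewrite !rmorphM /= gu gv.
  - by rewrite -yE.
  - by rewrite rmorphV ?(presented_unit presT) //= -yE; have [z /gV] := gy i.
move=> w; have [a [b [_ ->]]] := fracE w.
have [u <-] := gT a; have [v /gV[v' <-]] := gT b.
by exists (u * v'); rewrite rmorphM.
Qed.

End SkewFieldY.

(** * Linear forms and their bracket *)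

(** Additivity is a plain hypothesis so that coordinates and brackets with one argument fixed can be
    used without declaring structures on them. *)
Lemma additive_sum (V Z : zmodType) (f : V -> Z) (I : finType) (v : I -> V)
    (c : I -> int) : {morph f : x y / x + y} ->
  f (\sum_i v i *~ c i) = \sum_i f (v i) *~ c i.
Proof.
move=> fD; have f0 : f 0 = 0 by apply: (addrI (f 0)); rewrite -fD !addr0.
have fB : {morph f : x y / x - y}.
  by move=> x y; apply: (addIr (f y)); rewrite -fD !subrK.
pose fA := GRing.isZmodMorphism.Build V Z f fB.
pose g : {additive V -> Z} := HB.pack f fA.
by rewrite -[f]/(g : V -> Z) raddf_sum; apply: eq_bigr => i _; rewrite raddfMz.
Qed.

Lemma additive_mulrz (V Z : zmodType) (f : V -> Z) (v : V) (c : int) :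
  {morph f : x y / x + y} -> f (v *~ c) = f v *~ c.
Proof.
move=> fD; have := additive_sum (fun _ : 'I_1 => v) (fun=> c) fD.
by rewrite !big_ord1.
Qed.

Section LinearForms.
Variable R : realType.
Implicit Types (l m n : linform R) (k : 'I_3 + 'I_3) (c : R[i]).

Definition coord l k : int :=
  match k with inl i => l.2.1 0 i | inr i => l.2.2 0 i end.

Notation gen := (WA2_gens (@P R) (@U R)).

Lemma linform_eq l m : l.1 = m.1 -> coord l =1 coord m -> l = m.
Proof.
case: l m => [c [a b]] [c' [a' b']] /= -> lm; congr (_, (_, _)); apply/rowP => i.
  exact: (lm (inl i)).
exact: (lm (inr i)).
Qed.

Lemma coordD l m k : coord (l + m) k = coord l k + coord m k.
Proof. by case: l m k => [c [a b]] [c' [a' b']] [] i; rewrite /= mxE. Qed.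

Lemma coordN l k : coord (- l) k = - coord l k.
Proof. by case: l k => [c [a b]] [] i; rewrite /= mxE. Qed.

Lemma coordMz l z k : coord (l *~ z) k = coord l k * z.
Proof.
have cD : {morph coord^~ k : x y / x + y} by move=> x y; rewrite /= coordD.
by rewrite (additive_mulrz _ _ cD) mulrzz.
Qed.

Lemma coord_cst c k : coord (cst c) k = 0.
Proof. by case: k => i; rewrite /= mxE. Qed.

Lemma coord_gen k k' : coord (gen k) k' = (k == k')%:R.
Proof. by case: k k' => i [] j; rewrite /= !mxE ?eqxx //= eq_sym. Qed.

Arguments coord : simpl never.

Lemma cstD c d : cst (c + d) = cst c + cst d :> linform R.
Proof.
by apply: linform_eq => // k; rewrite coordD !coord_cst.
Qed.

Lemma cstN c : cst (- c) = - cst c :> linform R.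
Proof. by apply: linform_eq => // k; rewrite coordN !coord_cst oppr0. Qed.

Lemma cst0 : cst 0 = 0 :> linform R. Proof. by []. Qed.

(** Constants are fixed because their exponentials are scalars, which every algebra morphism
    fixes. *)
Definition lin_ext (F : 'I_3 + 'I_3 -> linform R) l : linform R :=
  cst l.1 + \sum_k F k *~ coord l k.

Lemma lin_ext_id l : lin_ext gen l = l.
Proof.
have cD k : {morph coord^~ k : x y / x + y} by move=> x y; rewrite /= coordD.
apply: linform_eq => [|k]; rewrite /lin_ext.
  have fD : {morph (fun m : linform R => m.1) : x y / x + y} by [].
  rewrite fD (additive_sum _ _ fD) big1 ?addr0 //= => -[i|i] _;
  by rewrite mul0rz.
rewrite coordD coord_cst add0r (additive_sum _ _ (cD k)) (bigD1 k) //= big1.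
  by rewrite coord_gen eqxx addr0 mulrzz mul1r.
by move=> j /negPf jk; rewrite coord_gen jk mul0rz.
Qed.

Lemma lin_extD F : {morph lin_ext F : l m / l + m}.
Proof.
move=> l m; rewrite /lin_ext /= cstD addrACA -big_split /=; congr (_ + _).
by apply: eq_bigr => k _; rewrite coordD mulrzDr.
Qed.

Lemma lin_ext_cst F c : lin_ext F (cst c) = cst c.
Proof. by rewrite /lin_ext big1 ?addr0 // => k _; rewrite coord_cst. Qed.

Lemma lin_ext_gen F k : lin_ext F (gen k) = F k.
Proof.
rewrite /lin_ext (bigD1 k) //= big1 => [|j /negPf jk].
  by rewrite coord_gen eqxx addr0 /=; case: k => i /=; rewrite add0r.
by rewrite coord_gen eq_sym jk.
Qed.

Lemma linform_additive_ext (Z : zmodType) (f g : linform R -> Z) :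
    {morph f : l m / l + m} -> {morph g : l m / l + m} ->
    (forall c, f (cst c) = g (cst c)) -> (forall k, f (gen k) = g (gen k)) ->
  f =1 g.
Proof.
move=> fD gD fgc fgk l; rewrite -(lin_ext_id l) /lin_ext fD gD fgc.
rewrite (additive_sum _ _ fD) (additive_sum _ _ gD).
by congr (_ + _); apply: eq_bigr => k _; rewrite fgk.
Qed.

(** The commutator divided by [hbar]. Being an integer, it can serve both as an exponent of [q] and
    as a multiplicity in a linear form. *)
Definition bracket l m : int :=
  \sum_i (coord l (inl i) * coord m (inr i) - coord l (inr i) * coord m (inl i)).

Lemma lin_bracketE hbar l m : lin_bracket hbar l m = hbar * (bracket l m)%:~R.
Proof. by []. Qed.

Lemma bracketDl n : {morph bracket^~ n : l m / l + m}.
Proof.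
move=> l m; rewrite /bracket -big_split; apply: eq_bigr => i _ /=.
by rewrite !coordD; ring.
Qed.

Lemma bracketC l m : bracket m l = - bracket l m.
Proof.
by rewrite /bracket -sumrN; apply: eq_bigr => i _; rewrite opprB mulrC [X in _ - X]mulrC.
Qed.

Lemma bracketDr n : {morph bracket n : l m / l + m}.
Proof. by move=> l m; rewrite bracketC bracketDl opprD -!bracketC. Qed.

Lemma bracketNl l m : bracket (- l) m = - bracket l m.
Proof.
by rewrite /bracket -sumrN; apply: eq_bigr => i _; rewrite !coordN; ring.
Qed.

Lemma bracketNr l m : bracket l (- m) = - bracket l m.
Proof. by rewrite bracketC bracketNl -bracketC. Qed.

Lemma bracketMzl l m z : bracket (l *~ z) m = bracket l m * z.
Proof.
by rewrite /bracket mulr_suml; apply: eq_bigr => i _; rewrite !coordMz; ring.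
Qed.

Lemma bracketMzr l m z : bracket l (m *~ z) = bracket l m * z.
Proof. by rewrite bracketC bracketMzl -mulNr -bracketC. Qed.

Lemma bracketll l : bracket l l = 0.
Proof. by rewrite /bracket big1 // => i _; rewrite mulrC subrr. Qed.

Lemma bracket_cstl c l : bracket (cst c) l = 0.
Proof. by rewrite /bracket big1 // => i _; rewrite !coord_cst !mul0r subrr. Qed.

Lemma bracket_cstr c l : bracket l (cst c) = 0.
Proof. by rewrite bracketC bracket_cstl oppr0. Qed.

Lemma bracket_P i l : bracket (P i) l = coord l (inr i).
Proof.
rewrite /bracket (bigD1 i) //= big1 => [|j /negPf ji].
  by rewrite !(coord_gen (inl i)) /eq_op /= !eqxx mul1r mul0r subr0 addr0.
by rewrite !(coord_gen (inl i)) /eq_op /= eq_sym ji !mul0r subr0.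
Qed.

Lemma bracket_U i l : bracket (U i) l = - coord l (inl i).
Proof.
rewrite /bracket (bigD1 i) //= big1 => [|j /negPf ji].
  by rewrite !(coord_gen (inr i)) /eq_op /= !eqxx mul1r mul0r sub0r addr0.
by rewrite !(coord_gen (inr i)) /eq_op /= eq_sym ji !mul0r subr0.
Qed.

Lemma coord_P i k : coord (P i) k = if k is inl j then (i == j)%:R else 0.
Proof. by rewrite (coord_gen (inl i)); case: k. Qed.

Lemma coord_U i k : coord (U i) k = if k is inr j then (i == j)%:R else 0.
Proof. by rewrite (coord_gen (inr i)); case: k. Qed.

Lemma bracket_gen k k' : bracket (gen k) (gen k') =
  match k, k' with
  | inl i, inr j => (i == j)%:R | inr i, inl j => - (i == j)%:R | _, _ => 0
  end.
Proof.
case: k k' => i [] j /=; rewrite ?bracket_P ?bracket_U ?coord_P ?coord_U ?oppr0 //;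
by rewrite eq_sym.
Qed.

Definition symplectic (L : linform R -> linform R) : Prop :=
  [/\ {morph L : l m / l + m}, forall c, L (cst c) = cst c
    & forall l m, bracket (L l) (L m) = bracket l m].

Lemma lin_ext_symplectic F :
  (forall k k', bracket (F k) (F k') = bracket (gen k) (gen k')) ->
  symplectic (lin_ext F).
Proof.
move=> FF; split=> [|c|l m]; [exact: lin_extD | exact: lin_ext_cst |].
(* One bilinear expansion serves for [F] and for [gen], where [lin_ext] is the identity. *)
pose b H l m := bracket (lin_ext H l) (lin_ext H m).
have bE H : b H l m = \sum_k (\sum_k' bracket (H k) (H k') *~ coord m k') *~ coord l k.
  rewrite /b /lin_ext bracketDl bracket_cstl add0r (additive_sum _ _ (bracketDl _)).
  apply: eq_bigr => k _; rewrite bracketDr bracket_cstr add0r.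
  by rewrite (additive_sum _ _ (bracketDr _)).
rewrite -/(b F l m) bE -[l in RHS]lin_ext_id -[m in RHS]lin_ext_id -/(b gen l m) bE.
by apply: eq_bigr => k _; congr (_ *~ _); apply: eq_bigr => k' _; rewrite FF.
Qed.

Lemma symplectic_comp L M : symplectic L -> symplectic M -> symplectic (L \o M).
Proof.
move=> [LD Lc Lb] [MD Mc Mb]; split=> [l m|c|l m] /=; first by rewrite MD LD.
  by rewrite Mc Lc.
by rewrite Lb Mb.
Qed.

Definition perm_form (s : 'S_3) : linform R -> linform R :=
  lin_ext (WA2_gens (fun i => P (s i)) (fun i => U (s i))).

(* e^{ad X} on linear forms, for X = hbar^-1 l m with [l, m] = 0. *)
Definition quad_form l m n : linform R :=
  n + l *~ bracket m n + m *~ bracket l n.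

(* e^{ad X} on linear forms, for X = (c / hbar) m. *)
Definition shift_form c m n : linform R := n + cst (c * (bracket m n)%:~R).

Lemma perm_form_symplectic s : symplectic (perm_form s).
Proof.
apply: lin_ext_symplectic => k k'.
have E j : WA2_gens (fun i => P (s i)) (fun i => U (s i)) j
           = gen (match j with inl i => inl (s i) | inr i => inr (s i) end).
  by case: j.
by rewrite !E !bracket_gen; case: k k' => i [] j //; rewrite (inj_eq perm_inj).
Qed.

Lemma perm_formK s t : (t * s = 1)%g -> cancel (perm_form t) (perm_form s).
Proof.
move=> ts; apply: linform_additive_ext => [||c|] //=.
- by move=> l m; rewrite /perm_form !lin_extD.
- by rewrite /perm_form !lin_ext_cst.
case=> i; rewrite /perm_form lin_ext_gen /=.
  by rewrite (lin_ext_gen _ (inl (t i))) /= -permM ts perm1.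
by rewrite (lin_ext_gen _ (inr (t i))) /= -permM ts perm1.
Qed.

(** All brackets among [l] and [m] vanish, and the terms pairing them with [n] and [n'] cancel by
    antisymmetry. *)
Lemma quad_form_symplectic l m : bracket l m = 0 -> symplectic (quad_form l m).
Proof.
move=> lm; have ml : bracket m l = 0 by rewrite bracketC lm oppr0.
split=> [n n'|c|n n']; rewrite /quad_form.
- by rewrite !bracketDr !mulrzDr (addrACA n) [LHS]addrACA.
- by rewrite !bracket_cstr !mulr0z !addr0.
have expand (a b : int) (k : linform R) : bracket (n + l *~ a + m *~ b) k =
    bracket n k + bracket l k * a + bracket m k * b.
  by rewrite bracketDl bracketDl bracketMzl bracketMzl.
have expandr (a b : int) (k : linform R) : bracket k (n' + l *~ a + m *~ b) =
    bracket k n' + bracket k l * a + bracket k m * b.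
  by rewrite bracketDr bracketDr bracketMzr bracketMzr.
rewrite expand !expandr !bracketll lm ml (bracketC l n) (bracketC m n); ring.
Qed.

(** Negating [l] alone negates the product [l m], hence replaces [e^{ad X}] by [e^{-ad X}]. *)
Lemma quad_formK l m : bracket l m = 0 -> cancel (quad_form l m) (quad_form (- l) m).
Proof.
move=> lm n; have ml : bracket m l = 0 by rewrite bracketC lm oppr0.
have expandr (k : linform R) (a b : int) : bracket k (n + l *~ a + m *~ b) =
    bracket k n + bracket k l * a + bracket k m * b.
  by rewrite bracketDr bracketDr bracketMzr bracketMzr.
rewrite /quad_form bracketNl !expandr !bracketll lm ml !mul0r !addr0.
by rewrite mulNrz mulrNz; rewrite addrAC addrK addrK.
Qed.

Lemma shift_form_symplectic c m : symplectic (shift_form c m).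
Proof.
split=> [n n'|d|n n']; rewrite /shift_form.
- by rewrite bracketDr intrD mulrDr cstD addrACA.
- by rewrite bracket_cstr mulr0 cst0 addr0.
by rewrite !(bracketDl, bracketDr, bracket_cstl, bracket_cstr) !addr0.
Qed.

Lemma shift_formK c m : cancel (shift_form c m) (shift_form (- c) m).
Proof.
move=> n; rewrite /shift_form bracketDr bracket_cstr addr0 -addrA -cstD.
by rewrite mulNr subrr cst0 addr0.
Qed.

End LinearForms.

Arguments coord : simpl never.

(** * Exponentials of linear forms *)

Section LinearExponentials.
Variables (R : realType) (hbar : R[i]).

Notation gen := (WA2_gens (@P R) (@U R)).

(** This abstracts [lin_exp] to a class stable under algebra morphisms on the left and symplectic
    maps on the right, in which a map is determined by its values on the six generators. Identities
    between morphisms then need no computation with ordered products. *)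
Definition exponential_map (A : unitAlgType R[i]) (e : linform R -> A) : Prop :=
  (forall l m, e l * e m = expC (lin_bracket hbar l m / 2) *: e (l + m)) /\
  (forall c, e (cst c) = (expC c)%:A).

Lemma exponential_mapN (A : unitAlgType R[i]) (e : linform R -> A) l :
  exponential_map e -> e l * e (- l) = 1.
Proof.
move=> [eM ec]; rewrite eM subrr -(cst0 R) ec lin_bracketE bracketNr bracketll.
by rewrite oppr0 mulr0 mul0r expC0 !scale1r.
Qed.

Lemma exponential_map_unit (A : unitAlgType R[i]) (e : linform R -> A) l :
  exponential_map e -> e l \is a GRing.unit.
Proof.
move=> ee; apply/unitrP; exists (e (- l)); split; last exact: exponential_mapN.
by rewrite -{2}[l]opprK exponential_mapN.
Qed.

Lemma exponential_mapV (A : unitAlgType R[i]) (e : linform R -> A) l :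
  exponential_map e -> (e l)^-1 = e (- l).
Proof.
move=> ee; apply: (mulrI (exponential_map_unit l ee)).
by rewrite exponential_mapN // mulrV // exponential_map_unit.
Qed.

Lemma exponential_map_comm (A : unitAlgType R[i]) (e : linform R -> A) l m :
  exponential_map e -> e l * e m = expC (lin_bracket hbar l m) *: (e m * e l).
Proof.
move=> [eM _]; rewrite !eM scalerA -expCD [m + l]addrC; congr (expC _ *: _).
by rewrite !lin_bracketE (bracketC l m) intrN; field.
Qed.

Lemma exponential_mapD_cst (A : unitAlgType R[i]) (e : linform R -> A) c l :
  exponential_map e -> e (cst c + l) = expC c *: e l.
Proof.
move=> [eM ec]; rewrite -[expC c *: _]mul1r -scalerAr scalerAl -ec eM.
by rewrite lin_bracketE bracket_cstl mulr0 mul0r expC0 scale1r.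
Qed.

Lemma exponential_map_eq (A : unitAlgType R[i]) (e f : linform R -> A) :
  exponential_map e -> exponential_map f ->
  (forall k, e (gen k) = f (gen k)) -> e =1 f.
Proof.
move=> ee ef efk.
have efD l m : e l = f l -> e m = f m -> e (l + m) = f (l + m).
  move=> efl efm; apply: (scalerI (expC_neq0 (lin_bracket hbar l m / 2))).
  by rewrite -(proj1 ee) -(proj1 ef) efl efm.
have efN l : e l = f l -> e (- l) = f (- l).
  by move=> efl; rewrite -!exponential_mapV // efl.
have efc c : e (cst c) = f (cst c) by rewrite (proj2 ee) (proj2 ef).
have ef0 : e 0 = f 0 by have := efc 0.
have efMn l n : e l = f l -> e (l *+ n) = f (l *+ n).
  by move=> efl; elim: n => [|n IHn]; rewrite ?mulrS //; apply: efD.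
move=> l; rewrite -(lin_ext_id l); apply: (efD) => //.
apply: (big_ind (fun m => e m = f m) ef0 efD) => k _.
by case: (coord l k) => n; rewrite ?NegzE ?mulrNz; [|apply: efN]; apply: efMn.
Qed.

Lemma exponential_map_rmorph (A B : unitAlgType R[i]) (g : {lrmorphism A -> B})
    (e : linform R -> A) : exponential_map e -> exponential_map (g \o e).
Proof.
move=> [eM ec]; split=> [l m|c] /=; first by rewrite -rmorphM eM /= linearZ.
by rewrite ec linearZ /= rmorph1.
Qed.

Lemma exponential_map_symplectic (A : unitAlgType R[i]) (e : linform R -> A) L :
  symplectic L -> exponential_map e -> exponential_map (e \o L).
Proof.
move=> [LD Lc Lb] [eM ec]; split=> [l m|c] /=; last by rewrite Lc ec.
by rewrite LD eM !lin_bracketE Lb.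
Qed.

Lemma exponential_map_relations (A : unitAlgType R[i]) (e : linform R -> A) (I : Type)
    (l : I -> linform R) (c : I -> I -> R[i]) :
  exponential_map e -> (forall i j, c i j = expC (lin_bracket hbar (l i) (l j))) ->
  qcomm_relations c (fun i => e (l i)) (fun i => (e (l i))^-1).
Proof.
move=> ee cE; split=> [i|i j]; last by rewrite (exponential_map_comm _ _ ee) cE.
by rewrite mulrV ?mulVr // exponential_map_unit.
Qed.

Section Generators.
Variables (A : unitAlgType R[i]) (ep eu : 'I_3 -> A).

Let e := lin_exp hbar ep eu.

Lemma lin_exp_gen k : e (gen k) = WA2_gens ep eu k.
Proof.
have e0 (g : 'I_3 -> A) : \prod_i g i ^ (0 : 'rV[int]_3) 0 i = 1.
  by rewrite big1 // => i _; rewrite mxE expr0z.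
have e1 (g : 'I_3 -> A) j : \prod_i g i ^ (delta_mx 0 j : 'rV[int]_3) 0 i = g j.
  rewrite (@big_only1 _ _ _ _ j) // => [|i /negPf ij _]; rewrite mxE ?eqxx //.
  by rewrite ij andbF.
have s0 i : \sum_j (delta_mx 0 i : 'rV[int]_3) 0 j * (0 : 'rV[int]_3) 0 j = 0.
  by rewrite big1 // => j _; rewrite [X in _ * X]mxE mulr0.
have s0' i : \sum_j (0 : 'rV[int]_3) 0 j * (delta_mx 0 i : 'rV[int]_3) 0 j = 0.
  by rewrite big1 // => j _; rewrite [X in X * _]mxE mul0r.
case: k => i; rewrite /e /lin_exp /= e0 e1 ?s0 ?s0'.
  by rewrite mulr0z mulr0 oppr0 mul0r expC0 !mulr1 scale1r.
by rewrite mulr0z mulr0 oppr0 mul0r expC0 mulr1 mul1r scale1r.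
Qed.

Lemma lin_exp_exponential_map :
    qcomm_relations (WA2_coef hbar) (WA2_gens ep eu) (fun k => (WA2_gens ep eu k)^-1) ->
  exponential_map e.
Proof.
move=> rel; split=> [l m|c]; first exact: lin_exp_BCH.
rewrite /e /lin_exp /= !big1 => [|i _|i _|i _]; rewrite ?mxE ?mul0r ?expr0z //.
by rewrite mulr0 oppr0 mul0r expC0 !mulr1.
Qed.

End Generators.

Lemma lin_exp_rmorph (A B : unitAlgType R[i]) (g : {lrmorphism A -> B})
    (ep eu : 'I_3 -> A) :
    let e := lin_exp hbar ep eu in
    let e' := lin_exp hbar (fun i => g (ep i)) (fun i => g (eu i)) in
  exponential_map e -> exponential_map e' -> forall l, g (e l) = e' l.
Proof.
move=> e e' ee ee'; apply: (exponential_map_eq (exponential_map_rmorph g ee) ee') => k.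
by rewrite /comp /e /e' !lin_exp_gen; case: k.
Qed.


Lemma WA2_coefE k k' : WA2_coef hbar k k' = expC (lin_bracket hbar (gen k) (gen k')).
Proof.
rewrite lin_bracketE bracket_gen; case: k k' => i [] j /=;
  rewrite ?mulr0 ?expC0 // /qpow; congr expC; rewrite mulrC.
  by rewrite ratr_nat; case: (i == j).
by rewrite eq_sym raddfN /= ratr_nat intrN; case: (i == j).
Qed.

End LinearExponentials.

(** * The adjoint action on linear forms *)

Section Weyl.
Variables (R : realType) (hbar : R[i]) (H : algType R[i]) (p u : 'I_3 -> H).
Hypothesis Hpu : canonical_relations hbar p u.
Hypothesis hbar_neq0 : hbar != 0.

Notation gen := (WA2_gens (@P R) (@U R)).
Notation val := (lin_val p u).

Lemma lin_valD : {morph val : l m / l + m}.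
Proof.
case=> [c [a b]] [c' [a' b']]; rewrite /lin_val /= scalerDl.
rewrite [RHS]addrACA [X in _ = X + _]addrACA -!big_split /=.
by congr (_ + _ + _); apply: eq_bigr => i _; rewrite mxE mulrzDr.
Qed.

Lemma lin_val_cst c : val (cst c) = c%:A.
Proof. by rewrite /lin_val /= !big1 ?addr0 // => i _; rewrite mxE. Qed.

Lemma lin_val0 : val 0 = 0.
Proof. by rewrite -(cst0 R) lin_val_cst scale0r. Qed.

Lemma lin_valN l : val (- l) = - val l.
Proof. by apply: (addIr (val l)); rewrite -lin_valD !addNr lin_val0. Qed.

Lemma lin_valMz l z : val (l *~ z) = val l *~ z.
Proof. exact: additive_mulrz lin_valD. Qed.

Lemma lin_val_gen k : val (gen k) = WA2_gens p u k.
Proof.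
have s0 (x : 'I_3 -> H) : \sum_i x i *~ (0 : 'rV[int]_3) 0 i = 0.
  by rewrite big1 // => i _; rewrite mxE.
have s1 (x : 'I_3 -> H) j : \sum_i x i *~ (delta_mx 0 j : 'rV[int]_3) 0 i = x j.
  rewrite (bigD1 j) //= big1 => [|i /negPf ij]; rewrite mxE ?eqxx ?ij //.
  by rewrite addr0.
by case: k => i; rewrite /lin_val /= s0 s1 scale0r ?addr0 add0r.
Qed.

Lemma lieDl (x y z : H) : lie (x + y) z = lie x z + lie y z.
Proof. by rewrite /lie mulrDl mulrDr opprD addrACA. Qed.

Lemma lieDr (x y z : H) : lie x (y + z) = lie x y + lie x z.
Proof. by rewrite /lie mulrDl mulrDr opprD addrACA. Qed.

Lemma lieC (x y : H) : lie y x = - lie x y.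
Proof. by rewrite /lie opprB. Qed.

Lemma lieZl c (x y : H) : lie (c *: x) y = c *: lie x y.
Proof. by rewrite /lie -scalerAl -scalerAr scalerBr. Qed.

Lemma lieAl c (x : H) : lie c%:A x = 0.
Proof. by rewrite lieZl /lie mul1r mulr1 subrr scaler0. Qed.

Lemma lieMl (x y z : H) : lie (x * y) z = x * lie y z + lie x z * y.
Proof. by rewrite /lie mulrBr mulrBl !mulrA addrA subrK. Qed.

Lemma lie_lin_val l m : lie (val l) (val m) = (lin_bracket hbar l m)%:A.
Proof.
have brDl n : {morph (fun l => (lin_bracket hbar l n)%:A : H) : x y / x + y}.
  by move=> x y; rewrite !lin_bracketE bracketDl intrD mulrDr scalerDl.
have brDr n : {morph (fun l => (lin_bracket hbar n l)%:A : H) : x y / x + y}.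
  by move=> x y; rewrite !lin_bracketE bracketDr intrD mulrDr scalerDl.
move: l; apply: linform_additive_ext (brDl m) _ _ => [x y|c|k].
- by rewrite lin_valD lieDl.
- by rewrite lin_val_cst lieAl lin_bracketE bracket_cstl mulr0 scale0r.
move: m {brDl}; apply: linform_additive_ext (brDr (gen k)) _ _ => [x y|c|k'].
- by rewrite lin_valD lieDr.
- by rewrite lin_val_cst lieC lieAl oppr0 lin_bracketE bracket_cstr mulr0 scale0r.
rewrite !lin_val_gen lin_bracketE bracket_gen; case: k k' => i [] j /=.
- by rewrite mulr0 scale0r; have [] := Hpu i j.
- by have [-> _ _] := Hpu i j; case: eqP => _; rewrite ?mulr1 ?mulr0.
- rewrite lieC eq_sym; have [-> _ _] := Hpu j i.
  by rewrite mulrNz mulrN scaleNr; case: eqP => _; rewrite ?mulr1 ?mulr0.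
- by rewrite mulr0 scale0r; have [] := Hpu i j.
Qed.

(** A form with value 0 commutes with everything, so its brackets with the generators vanish as
    [hbar] is nonzero; only a constant is left, and it must be 0. This makes the exponent produced
    by [e^{ad X}] unambiguous. *)
Lemma lin_val_inj : injective val.
Proof.
move=> l m lm; suff : l - m = 0 by move/eqP; rewrite subr_eq0 => /eqP.
have v0 : val (l - m) = 0 by rewrite lin_valD lin_valN lm subrr.
move: (l - m) v0 => {lm m}l v0.
have br0 m : bracket l m = 0.
  have := lie_lin_val l m; rewrite v0 lin_bracketE {1}/lie mul0r mulr0 subrr.
  move/esym/eqP; rewrite scaler_eq0 oner_eq0 orbF mulf_eq0 (negPf hbar_neq0) /=.
  by rewrite intr_eq0 => /eqP.
have c0 k : coord l k = 0.
  case: k => i; first by apply: oppr_inj; rewrite -bracket_U bracketC br0.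
  by rewrite -bracket_P bracketC br0 oppr0.
have lc : l = cst l.1.
  by rewrite -[LHS]lin_ext_id /lin_ext big1 ?addr0 // => k _; rewrite c0.
move: v0; rewrite lc lin_val_cst => /eqP; rewrite scaler_eq0 oner_eq0 orbF => /eqP ->.
exact: cst0.
Qed.

(** The truncation length is existential, but once an iterate of [lie X] is 0 all later terms are 0
    too. *)
Lemma exp_ad_unique (X y z z' : H) : exp_ad X y z -> exp_ad X y z' -> z = z'.
Proof.
have ad0 n : iter n (lie X) 0 = 0.
  by elim: n => //= n ->; rewrite /lie mul0r mulr0 subrr.
have extend n d : iter n (lie X) y = 0 ->
    \sum_(k < n + d) (k`!%:R)^-1 *: iter k (lie X) y =
    \sum_(k < n) (k`!%:R)^-1 *: iter k (lie X) y :> H.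
  move=> n0; rewrite big_split_ord /= [X in _ + X]big1 ?addr0 // => k _.
  by rewrite addnC iterD n0 ad0 scaler0.
move=> [n [n0 ->]] [n' [n0' ->]].
by rewrite -(extend n n') // addnC extend.
Qed.

(** A single [ad X] lands in the span of [l] and [m], which [ad X] kills because they commute; the
    series stops after two terms. *)
Lemma exp_ad_quad l m n : bracket l m = 0 ->
  exp_ad (hbar^-1 *: (val l * val m)) (val n) (val (quad_form l m n)).
Proof.
move=> lm.
have step k : lie (hbar^-1 *: (val l * val m)) (val k) =
    val (l *~ bracket m k + m *~ bracket l k).
  rewrite lieZl lieMl !lie_lin_val !lin_bracketE -scalerAr -scalerAl mulr1 mul1r.
  rewrite scalerDr !scalerA !mulrA mulVf // !mul1r !scaler_int.
  move: (bracket m k) (bracket l k) => a b.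
  by rewrite lin_valD (lin_valMz l) (lin_valMz m).
have step2 a b : lie (hbar^-1 *: (val l * val m)) (val (l *~ a + m *~ b)) = 0.
  rewrite step !bracketDr (bracketMzr m l) (bracketMzr l l) (bracketMzr m m).
  rewrite (bracketMzr l m) !bracketll (bracketC l m) lm oppr0 !mul0r !addr0.
  by rewrite !mulr0z ?addr0 lin_val0.
exists 2%N; rewrite 2!big_ord_recl big_ord0 addr0 /= step step2; split=> //.
by rewrite invr1 !scale1r -lin_valD addrA.
Qed.

(** Here [ad X] turns a linear form into a scalar, so again two terms suffice. *)
Lemma exp_ad_shift c m n :
  exp_ad ((c / hbar) *: val m) (val n) (val (shift_form c m n)).
Proof.
have step k : lie ((c / hbar) *: val m) (val k) = val (cst (c * (bracket m k)%:~R)).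
  rewrite lieZl lie_lin_val lin_bracketE scalerA lin_val_cst mulrA divfK //.
exists 2%N; rewrite 2!big_ord_recl big_ord0 addr0 /= !step; split.
  by rewrite bracket_cstr mulr0 lin_val_cst scale0r.
by rewrite invr1 !scale1r -lin_valD.
Qed.

End Weyl.

(** * Automorphisms of W(A_2) and of its skew field of fractions *)

Section Automorphisms.
Variables (R : realType) (hbar : R[i]).

Notation gen := (WA2_gens (@P R) (@U R)).

Definition realizes (A : unitAlgType R[i]) (ep eu : 'I_3 -> A)
    (L : linform R -> linform R) (g : A -> A) : Prop :=
  forall l, g (lin_exp hbar ep eu l) = lin_exp hbar ep eu (L l).

Definition has_automorphism (A : unitAlgType R[i]) (ep eu : 'I_3 -> A)
    (L : linform R -> linform R) : Prop :=
  exists g : {lrmorphism A -> A}, bijective g /\ realizes ep eu L g.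

(** The rigidity shared by W(A_2), by its presentation, and by its fractions; it lets the same
    arguments run for both algebras. *)
Definition determined_by (A : unitAlgType R[i]) (ep eu : 'I_3 -> A) : Prop :=
  forall g h : {lrmorphism A -> A},
  (forall k, g (WA2_gens ep eu k) = h (WA2_gens ep eu k)) -> g =1 h.

(** The inverse must be symplectic as well, so that it induces the inverse algebra morphism. *)
Definition symplectomorphism (L : linform R -> linform R) : Prop :=
  exists M, [/\ symplectic L, symplectic M, cancel L M & cancel M L].

Lemma symplectomorphism_comp L M :
  symplectomorphism L -> symplectomorphism M -> symplectomorphism (L \o M).
Proof.
move=> [L' [sL sL' LL' L'L]] [M' [sM sM' MM' M'M]]; exists (M' \o L').
by split; do ?exact: symplectic_comp; exact: can_comp.
Qed.

Lemma realizes_eq (A : unitAlgType R[i]) (ep eu : 'I_3 -> A) L M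
    (g h : {lrmorphism A -> A}) :
  determined_by ep eu -> L =1 M -> realizes ep eu L g -> realizes ep eu M h -> g =1 h.
Proof.
by move=> detA LM gL hM; apply: detA => k; rewrite -!(lin_exp_gen hbar) gL hM LM.
Qed.

Lemma realizes_comp (A : unitAlgType R[i]) (ep eu : 'I_3 -> A) L M
    (g h : {lrmorphism A -> A}) :
  realizes ep eu L g -> realizes ep eu M h -> realizes ep eu (L \o M) (g \o h).
Proof. by move=> gL hM l; rewrite /= hM gL. Qed.

Lemma has_automorphismP (A : unitAlgType R[i]) (ep eu : 'I_3 -> A) :
    determined_by ep eu ->
    (forall L, symplectomorphism L -> exists g : {lrmorphism A -> A}, realizes ep eu L g) ->
  forall L, symplectomorphism L -> has_automorphism ep eu L.
Proof.
move=> detA exA L [M [sL sM LM ML]].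
have [g gL] := exA L (ex_intro _ M (And4 sL sM LM ML)).
have [h hM] := exA M (ex_intro _ L (And4 sM sL ML LM)).
have id_id : realizes ep eu id (idfun : {lrmorphism A -> A}) by [].
exists g; split=> //; exists h.
  apply: (realizes_eq (h := idfun) (g := h \o g) detA LM _ id_id).
  exact: realizes_comp.
apply: (realizes_eq (h := idfun) (g := g \o h) detA ML _ id_id).
exact: realizes_comp.
Qed.

Section WA2.
Variables (W : unitAlgType R[i]) (ep eu : 'I_3 -> W).
Hypothesis HW : is_WA2 hbar ep eu.

Lemma WA2_exponential_map : exponential_map hbar (lin_exp hbar ep eu).
Proof. by apply: lin_exp_exponential_map; have [] := HW. Qed.

Lemma WA2_determined : determined_by ep eu.
Proof. by move=> g h gh; apply: (presented_eq HW). Qed.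

Lemma WA2_automorphism L : symplectomorphism L -> has_automorphism ep eu L.
Proof.
move: L; apply: has_automorphismP WA2_determined _ => L [_ [sL _ _ _]].
have eL := exponential_map_symplectic sL WA2_exponential_map.
have [_ /(_ W _ _ (exponential_map_relations (l := gen) eL (@WA2_coefE _ _)))] := HW.
move=> [g [gE _]].
exists g; apply: (exponential_map_eq (exponential_map_rmorph g WA2_exponential_map) eL).
by move=> k; rewrite /comp lin_exp_gen gE.
Qed.

Variables (F : unitAlgType R[i]) (emb : {lrmorphism W -> F}).
Hypothesis fracF : skew_field_of_fractions emb.

Let Fep i := emb (ep i).
Let Feu i := emb (eu i).

Lemma frac_WA2_exponential_map : exponential_map hbar (lin_exp hbar Fep Feu).
Proof.
apply: lin_exp_exponential_map.
have embg k : WA2_gens Fep Feu k = emb (WA2_gens ep eu k) by case: k.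
have [[WV WC] _] := HW; split=> [k|k k']; last first.
  by rewrite !embg -!rmorphM WC /= linearZ.
by rewrite embg mulrV ?mulVr // rmorph_unit // (presented_unit HW).
Qed.

Lemma frac_WA2_lin_exp l : emb (lin_exp hbar ep eu l) = lin_exp hbar Fep Feu l.
Proof. exact: lin_exp_rmorph WA2_exponential_map frac_WA2_exponential_map l. Qed.

Lemma frac_WA2_determined : determined_by Fep Feu.
Proof.
move=> g h gh; apply: (fractions_eq fracF) => t.
apply: (presented_eq HW (g := g \o emb) (h := h \o emb)) => k /=.
by have := gh k; case: k.
Qed.

(** The injectivity required for lifting to fractions comes from bijectivity on W(A_2). *)
Lemma frac_WA2_automorphism L : symplectomorphism L -> has_automorphism Fep Feu L.
Proof.
move: L; apply: has_automorphismP frac_WA2_determined _ => L sL.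
have [g [g_bij gL]] := WA2_automorphism sL.
have [skF emb_inj _] := fracF.
have eg_inj : injective (emb \o g) := inj_comp emb_inj (bij_inj g_bij).
have [h hE] := fractions_lift (f := emb \o g) fracF skF eg_inj.
by exists h => l; rewrite -!frac_WA2_lin_exp hE /= gL.
Qed.

End WA2.

Section AdjointAction.
Variables (H : algType R[i]) (p u : 'I_3 -> H).
Variables (A : unitAlgType R[i]) (ep eu : 'I_3 -> A).
Hypothesis detA : determined_by ep eu.

(** [is_Ad] asks for an actual morphism for each factor. The two [has_automorphism] hypotheses
    supply them when only the action of the composite is known. *)
Lemma is_Ad_cons (x : factor H) (xs : seq (factor H)) L M :
    (forall g : {lrmorphism A -> A},
      is_Ad_factor hbar p u ep eu x g <-> realizes ep eu L g) ->
    has_automorphism ep eu L -> has_automorphism ep eu M ->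
    (forall h : {lrmorphism A -> A}, is_Ad hbar p u ep eu xs h <-> realizes ep eu M h) ->
  forall f : {lrmorphism A -> A},
  is_Ad hbar p u ep eu (x :: xs) f <-> realizes ep eu (L \o M) f.
Proof.
move=> xL [g [g_bij gL]] [h [_ hM]] xsM f; split=> [|fLM].
  move=> [g' [h' [_ /xL g'L /xsM h'M fE]]] l.
  by rewrite fE; apply: (realizes_comp g'L h'M).
exists g, h; split=> //; [exact/xL | exact/xsM |].
apply: (realizes_eq (g := f) (h := g \o h) detA (frefl _) fLM).
exact: realizes_comp.
Qed.

Lemma is_Ad_nil (f : {lrmorphism A -> A}) :
  is_Ad hbar p u ep eu [::] f <-> realizes ep eu id f.
Proof.
split=> [fE l|f1]; first by rewrite fE.
by apply: (realizes_eq (h := idfun) detA (frefl id) f1).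
Qed.

Lemma is_Ad_ext (xs : seq (factor H)) (f f' : A -> A) :
  f =1 f' -> is_Ad hbar p u ep eu xs f -> is_Ad hbar p u ep eu xs f'.
Proof.
case: xs => [|x xs] ff' /=; first by move=> fE y; rewrite -ff'.
by move=> [g [h [? ? ? fE]]]; exists g, h; split=> // y; rewrite -ff'.
Qed.

Hypothesis Hpu : canonical_relations hbar p u.
Hypothesis hbar_neq0 : hbar != 0.
Hypothesis expA : exponential_map hbar (lin_exp hbar ep eu).

(** The resulting form is existential in [is_Ad_factor]; uniqueness of [e^{ad X}] and injectivity of
    [lin_val] force it to be [L l]. *)
Lemma is_Ad_factor_Exp X L :
    (forall l, exp_ad X (lin_val p u l) (lin_val p u (L l))) ->
  forall g : {lrmorphism A -> A},
  is_Ad_factor hbar p u ep eu (Exp X) g <-> realizes ep eu L g.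
Proof.
move=> XL g; split=> [gX l|gL l]; last by exists (L l).
have [l' [Xl' ->]] := gX l; congr lin_exp.
exact: (lin_val_inj Hpu hbar_neq0 (exp_ad_unique Xl' (XL l))).
Qed.

Lemma is_Ad_factor_Perm s (g : {lrmorphism A -> A}) :
  is_Ad_factor hbar p u ep eu (Perm s) g <-> realizes ep eu (perm_form s) g.
Proof.
have gen_s k : lin_exp hbar ep eu (perm_form s (gen k)) =
    WA2_gens (fun i => ep (s i)) (fun i => eu (s i)) k.
  rewrite /perm_form lin_ext_gen; case: k => i.
    exact: (lin_exp_gen hbar ep eu (inl (s i))).
  exact: (lin_exp_gen hbar ep eu (inr (s i))).
split=> [gs|gs i].
  apply: exponential_map_eq (exponential_map_rmorph g expA)
    (exponential_map_symplectic (perm_form_symplectic R s) expA) _ => k.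
  by rewrite /comp gen_s lin_exp_gen; case: k => i; have [] := gs i.
have gk k : g (WA2_gens ep eu k) = WA2_gens (fun i => ep (s i)) (fun i => eu (s i)) k.
  by rewrite -gen_s -(lin_exp_gen hbar) gs.
by split; [exact: (gk (inl i)) | exact: (gk (inr i))].
Qed.

End AdjointAction.

End Automorphisms.

(** * The two quivers *)

(* Twice the quiver matrix, so that it is integral. *)
Definition arrow_count (Q : quiver) (n : nat) (i j : 'I_n) : int :=
  let count s : int :=
    (count_mem (i.+1, j.+1) s)%:Z - (count_mem (j.+1, i.+1) s)%:Z in
  count (solid Q) + count (solid Q) + count (dashed Q).

Lemma qpow_quiver (R : realType) (hbar : R[i]) (Q : quiver) (n : nat) (i j : 'I_n) :
  qpow hbar (2 * quiver_matrix n Q i j) = expC (hbar * (arrow_count Q i j)%:~R).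
Proof.
rewrite /qpow mulrC; congr (expC (_ * _)); rewrite -[RHS](ratr_int); congr ratr.
by rewrite mxE /signed_count /arrow_count !(intrD, intrN) -!pmulrn; field.
Qed.

Section Proposition.
Variables (R : realType) (hbar : R[i]) (lam : 'I_3 -> R[i]).

Notation gen := (WA2_gens (@P R) (@U R)).

(* The factors kappa_j = e^{lambda_j} are moved into the exponents. *)
Definition phi_form : 'I_5 -> linform R :=
  tnth [tuple cst (- lam i2) + (P i2 - U i2 - P i1);
              cst (lam i2) + (P i2 + U i2 - P i3);
              cst (- lam i1) + (P i1 - U i1);
              cst (lam i1 - lam i3) + (P i1 + U i1 + P i3 - U i3 - P i2);
              cst (lam i3) + (P i3 + U i3)].

Definition phi'_form : 'I_5 -> linform R :=
  tnth [tuple cst (- lam i3) + (P i3 - U i3);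
              cst (lam i1) + (P i1 + U i1);
              cst (- lam i2) + (P i2 - U i2 - P i3);
              cst (- lam i1 + lam i3) + (P i3 + U i3 + P i1 - U i1 - P i2);
              cst (lam i2) + (P i2 + U i2 - P i1)].

Definition pi_form : linform R -> linform R := lin_ext (WA2_gens (pi_p lam) (pi_u R)).

Lemma phi_gensE (A : unitAlgType R[i]) (ep eu : 'I_3 -> A) i :
  exponential_map hbar (lin_exp hbar ep eu) ->
  phi_gens hbar lam ep eu i = lin_exp hbar ep eu (phi_form i).
Proof.
move=> ee; rewrite /phi_gens /phi_form !(tnth_nth 0).
case: i => -[|[|[|[|[|//]]]]] ? /=; rewrite (exponential_mapD_cst _ _ ee) /kappa;
  by rewrite -?expCN -?expCD.
Qed.

Lemma phi'_gensE (A : unitAlgType R[i]) (ep eu : 'I_3 -> A) i :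
  exponential_map hbar (lin_exp hbar ep eu) ->
  phi'_gens hbar lam ep eu i = lin_exp hbar ep eu (phi'_form i).
Proof.
move=> ee; rewrite /phi'_gens /phi'_form !(tnth_nth 0).
case: i => -[|[|[|[|[|//]]]]] ? /=; rewrite (exponential_mapD_cst _ _ ee) /kappa;
  by rewrite -?expCN -?expCD.
Qed.

Lemma pi_gensE (A : unitAlgType R[i]) (ep eu : 'I_3 -> A) k :
  pi_gens hbar lam ep eu k = lin_exp hbar ep eu (pi_form (gen k)).
Proof. by rewrite /pi_form lin_ext_gen; case: k. Qed.

(* Coefficients of the forms above on p_1, p_2, p_3 and on u_1, u_2, u_3. *)
Definition phi_p : seq (seq int) :=
  [:: [:: -1; 1; 0]; [:: 0; 1; -1]; [:: 1; 0; 0]; [:: 1; -1; 1]; [:: 0; 0; 1]].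

Definition phi_u : seq (seq int) :=
  [:: [:: 0; -1; 0]; [:: 0; 1; 0]; [:: -1; 0; 0]; [:: 1; 0; -1]; [:: 0; 0; 1]].

Definition phi'_p : seq (seq int) :=
  [:: [:: 0; 0; 1]; [:: 1; 0; 0]; [:: 0; 1; -1]; [:: 1; -1; 1]; [:: -1; 1; 0]].

Definition phi'_u : seq (seq int) :=
  [:: [:: 0; 0; -1]; [:: 1; 0; 0]; [:: 0; -1; 0]; [:: -1; 0; 1]; [:: 0; 1; 0]].

Lemma coord_phi i k : coord (phi_form i) k =
  match k with inl j => (nth [::] phi_p i)`_j | inr j => (nth [::] phi_u i)`_j end.
Proof.
rewrite /phi_form !(tnth_nth 0).
by case: i k => -[|[|[|[|[|//]]]]] ? [] [[|[|[|//]]] ?] /=;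
  rewrite !(coordD, coordN, coord_cst, coord_P, coord_U).
Qed.

Lemma coord_phi' i k : coord (phi'_form i) k =
  match k with inl j => (nth [::] phi'_p i)`_j | inr j => (nth [::] phi'_u i)`_j end.
Proof.
rewrite /phi'_form !(tnth_nth 0).
by case: i k => -[|[|[|[|[|//]]]]] ? [] [[|[|[|//]]] ?] /=;
  rewrite !(coordD, coordN, coord_cst, coord_P, coord_U).
Qed.

Lemma bracket_phi i j : bracket (phi_form i) (phi_form j) = arrow_count J121 i j.
Proof.
rewrite /bracket !big_ord_recl big_ord0 !coord_phi.
by case: i => -[|[|[|[|[|//]]]]] ?; case: j => -[|[|[|[|[|//]]]]] ?.
Qed.

Lemma bracket_phi' i j : bracket (phi'_form i) (phi'_form j) = arrow_count J212 i j.
Proof.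
rewrite /bracket !big_ord_recl big_ord0 !coord_phi'.
by case: i => -[|[|[|[|[|//]]]]] ?; case: j => -[|[|[|[|[|//]]]]] ?.
Qed.

(** Brackets with the generators read off the coordinates up to sign, so this is linear independence
    over the integers of the forms modulo constants. *)
Definition bracket_free (n : nat) (l : 'I_n -> linform R) : Prop :=
  forall v : 'I_n -> int, (forall k, \sum_i bracket (gen k) (l i) * v i = 0) ->
  forall i, v i = 0.

Lemma phi_free : bracket_free phi_form.
Proof.
(* Indexing the unknowns by [nat] removes the ordinal proofs, so that [lra] sees just five atoms in
   the six equations. *)
move=> v ker; pose w (m : nat) := v (inord m).
have vw i : v i = w i by rewrite /w inord_val.
have kerP (j : 'I_3) : \sum_(i < 5) (nth [::] phi_u i)`_j * w i = 0.
  by rewrite -[RHS](ker (inl j)); apply: eq_bigr => i _; rewrite bracket_P coord_phi vw.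
have kerU (j : 'I_3) : \sum_(i < 5) (nth [::] phi_p i)`_j * w i = 0.
  apply: oppr_inj; rewrite oppr0 -[RHS](ker (inr j)) -sumrN; apply: eq_bigr => i _.
  by rewrite bracket_U coord_phi mulNr vw.
move: (kerP i1) (kerP i2) (kerP i3) (kerU i1) (kerU i2) (kerU i3).
rewrite !big_ord_recl !big_ord0 /bump /= => ? ? ? ? ? ? i; rewrite vw.
by case: i => -[|[|[|[|[|//]]]]] ? /=; lra.
Qed.

Lemma phi'_free : bracket_free phi'_form.
Proof.
move=> v ker; pose w (m : nat) := v (inord m).
have vw i : v i = w i by rewrite /w inord_val.
have kerP (j : 'I_3) : \sum_(i < 5) (nth [::] phi'_u i)`_j * w i = 0.
  by rewrite -[RHS](ker (inl j)); apply: eq_bigr => i _; rewrite bracket_P coord_phi' vw.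
have kerU (j : 'I_3) : \sum_(i < 5) (nth [::] phi'_p i)`_j * w i = 0.
  apply: oppr_inj; rewrite oppr0 -[RHS](ker (inr j)) -sumrN; apply: eq_bigr => i _.
  by rewrite bracket_U coord_phi' mulNr vw.
move: (kerP i1) (kerP i2) (kerP i3) (kerU i1) (kerU i2) (kerU i3).
rewrite !big_ord_recl !big_ord0 /bump /= => ? ? ? ? ? ? i; rewrite vw.
by case: i => -[|[|[|[|[|//]]]]] ? /=; lra.
Qed.

(* Conjugation by the e^{p_i} and e^{u_i} separates the monomials in the e (l i). *)
Lemma form_morphism_inj (n : nat) (c : 'I_n -> 'I_n -> R[i]) (T A : unitAlgType R[i])
    (x : 'I_n -> T) (l : 'I_n -> linform R) (e : linform R -> A)
    (f : {lrmorphism T -> A}) :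
    (forall n, (0 < n)%N -> expC hbar ^+ n != 1) ->
    qcomm_presented c x -> (forall i j, c i j != 0) -> exponential_map hbar e ->
    (forall i, f (x i) = e (l i)) -> bracket_free l ->
  injective f.
Proof.
move=> generic presT c0 ee fx lfree.
apply: (@torus_morphism_inj _ T A _ _ c x f (expC hbar) (e \o gen)
  (fun k i => bracket (gen k) (l i)) presT c0) => // [|k|k i].
- exact: expC_neq0.
- exact: exponential_map_unit ee.
by rewrite fx /= (exponential_map_comm _ _ ee) lin_bracketE expCMz.
Qed.

Lemma skew_field_Y_form_lift (Q : quiver) (n : nat) (F A : unitAlgType R[i])
    (y : 'I_n -> F) (l : 'I_n -> linform R) (e : linform R -> A) :
    (forall n, (0 < n)%N -> expC hbar ^+ n != 1) ->
    is_skew_field_Y hbar (quiver_matrix n Q) y -> skew_field A ->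
    exponential_map hbar e ->
    (forall i j, bracket (l i) (l j) = arrow_count Q i j) -> bracket_free l ->
  exists g : {lrmorphism F -> A}, morphism_given_by y (e \o l) g.
Proof.
move=> generic FY skA ee lQ lfree; apply: (skew_field_Y_lift FY skA).
  apply: (exponential_map_relations ee) => i j.
  by rewrite qpow_quiver lin_bracketE lQ.
move=> T x f presT fx; apply: (form_morphism_inj generic presT _ ee fx lfree) => i j.
exact: expC_neq0.
Qed.

(** * The factors of [P123] and the map tau on linear forms *)

Definition swap_form : linform R -> linform R := perm_form (tperm i2 i3).
Definition p1u_form : linform R -> linform R := quad_form (P i1) (U i3 - U i2).
Definition lam_form : linform R -> linform R :=
  shift_form (lam i2 - lam i3) (U i3 - U i1).

Lemma bracket_p1u : bracket (P i1 : linform R) (U i3 - U i2) = 0.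
Proof. by rewrite bracket_P coordD coordN !coord_U. Qed.

Lemma swap_symplectomorphism : symplectomorphism swap_form.
Proof.
exists swap_form; have tt : (tperm i2 i3 * tperm i2 i3 = 1)%g by rewrite tperm2.
by split; [exact: perm_form_symplectic | exact: perm_form_symplectic |
  exact: perm_formK | exact: perm_formK].
Qed.

Lemma p1u_symplectomorphism : symplectomorphism p1u_form.
Proof.
have b0 := bracket_p1u; have b0' : bracket (- P i1 : linform R) (U i3 - U i2) = 0.
  by rewrite bracketNl b0 oppr0.
exists (quad_form (- P i1) (U i3 - U i2)).
split; [exact: quad_form_symplectic | exact: quad_form_symplectic | exact: quad_formK |].
by have := quad_formK b0'; rewrite opprK.
Qed.

Lemma lam_symplectomorphism : symplectomorphism lam_form.
Proof.
exists (shift_form (- (lam i2 - lam i3)) (U i3 - U i1)).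
split; try exact: shift_form_symplectic; first exact: shift_formK.
by have := @shift_formK R (- (lam i2 - lam i3)) (U i3 - U i1); rewrite opprK.
Qed.

Lemma ord3 (i : 'I_3) : [\/ i = i1, i = i2 | i = i3].
Proof.
by case: i => -[|[|[|//]]] ?; [apply: Or31 | apply: Or32 | apply: Or33]; apply: val_inj.
Qed.

(** The rightmost factor acts first. It shifts [p_1] and [p_3] by opposite constants; the middle one
    adds [p_1] to [p_2], subtracts it from [p_3] and adds [u_3 - u_2] to [u_1]; then the indices 2
    and 3 are exchanged, leaving the constants alone. *)
Lemma P123_form : swap_form \o (p1u_form \o lam_form) =1 pi_form.
Proof.
have [[sD sc _] [qD qc _]] : symplectic swap_form /\ symplectic p1u_form.
  by split; [have [? []] := swap_symplectomorphism | have [? []] := p1u_symplectomorphism].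
have [tD tc _] : symplectic lam_form by have [? []] := lam_symplectomorphism.
have brU a b l : bracket (U a - U b) l = coord l (inl b) - coord l (inl a).
  by rewrite bracketDl bracketNl !bracket_U opprK addrC.
have sN l : swap_form (- l) = - swap_form l.
  by apply: (addIr (swap_form l)); rewrite -sD !addNr -(cst0 R) sc.
have sP i : swap_form (P i) = P (tperm i2 i3 i) by apply: (lin_ext_gen _ (inl i)).
have sU i : swap_form (U i) = U (tperm i2 i3 i) by apply: (lin_ext_gen _ (inr i)).
have s1 : tperm i2 i3 i1 = i1 by rewrite tpermD.
apply: linform_additive_ext => [l m|l m|c|k]; first by rewrite /= tD qD sD.
- exact: lin_extD.
- by rewrite /pi_form lin_ext_cst /= tc qc sc.
rewrite /pi_form lin_ext_gen /= /lam_form /shift_form qD qc /p1u_form /quad_form.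
rewrite !brU !bracket_P.
have e12 : (i1 == i2) = false by []. have e13 : (i1 == i3) = false by [].
have e21 : (i2 == i1) = false by []. have e23 : (i2 == i3) = false by [].
have e31 : (i3 == i1) = false by []. have e32 : (i3 == i2) = false by [].
have tE : (tperm i2 i3 i2 = i3) * (tperm i2 i3 i3 = i2) by rewrite tpermL tpermR.
pose simp :=
  (subr0, sub0r, subrr, mulr0, mulr1, mulr0z, mulr1z, mulrNz, mulrN, addr0, cst0 R).
case: k => i; case: (ord3 i) => ->;
  rewrite /= ?coord_P ?coord_U ?eqxx ?(e12, e13, e21, e23, e31, e32) !simp;
  rewrite !(sD, sN, sc, sP, sU, s1, tE) /pi_p /pi_u ?(tnth_nth 0) //=.
(* The remaining cases are [p_2], [p_3] and [u_1]. *)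
- exact: addrC.
- by rewrite cstN.
- exact: addrA.
Qed.

Lemma P123_symplectomorphism : symplectomorphism (swap_form \o (p1u_form \o lam_form)).
Proof.
apply: symplectomorphism_comp swap_symplectomorphism _.
exact: symplectomorphism_comp p1u_symplectomorphism lam_symplectomorphism.
Qed.

(** No trace of [q^-1] remains: the arrows from 2 and 3 to 4 are solid, so the brackets are 2 and
    the BCH scalar is exactly [q]. *)
Definition tau_form : 'I_5 -> linform R :=
  let Y k := phi_form (inord k.-1) in
  tnth [tuple Y 1%N; Y 2 + Y 4; Y 3 + Y 4; - Y 4; Y 5].

Lemma tau_gensE (F A : unitAlgType R[i]) (y : 'I_5 -> F) (g : {lrmorphism F -> A})
    (e : linform R -> A) i :
    exponential_map hbar e -> (forall i, y i \is a GRing.unit) ->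
    (forall i, g (y i) = e (phi_form i)) ->
  g (tau_gens hbar y i) = e (tau_form i).
Proof.
move=> ee uy gy; have q2 j k : arrow_count J121 j k = 2 ->
    g ((expC hbar)^-1 *: (y j * y k)) = e (phi_form j + phi_form k).
  move=> jk; rewrite linearZ rmorphM /= !gy (proj1 ee) -expCN scalerA -expCD.
  rewrite lin_bracketE bracket_phi jk.
  have -> : - hbar + hbar * 2%:~R / 2 = 0 by field.
  by rewrite expC0 scale1r.
rewrite /tau_gens /tau_form !(tnth_nth 0).
case: i => -[|[|[|[|[|//]]]]] ? /=; rewrite ?gy //.
- by apply: q2; rewrite /arrow_count !inordK.
- by apply: q2; rewrite /arrow_count !inordK.
- by rewrite rmorphV //= gy (exponential_mapV _ ee).
Qed.

(** The constants are compared too, which is what the shifts in [pi_p] are for: on the first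
    generator they turn [- lam i3] into [- lam i2]. *)
Lemma pi_phi'_form i : pi_form (phi'_form i) = tau_form i.
Proof.
have piN l : pi_form (- l) = - pi_form l.
  by apply: (addIr (pi_form l)); rewrite -lin_extD !addNr -(cst0 R) lin_ext_cst.
have piD : {morph pi_form : l m / l + m} by exact: lin_extD.
have pic c : pi_form (cst c) = cst c by exact: lin_ext_cst.
have piP j : pi_form (P j) = pi_p lam j by apply: (lin_ext_gen _ (inl j)).
have piU j : pi_form (U j) = pi_u R j by apply: (lin_ext_gen _ (inr j)).
have fstD (l m : linform R) : (l + m).1 = l.1 + m.1 by [].
have fstN (l : linform R) : (- l).1 = - l.1 by [].
have fstG : (forall c : R[i], (cst c).1 = c) * (forall i, (@P R i).1 = 0)
  * (forall i, (@U R i).1 = 0) by [].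
rewrite /phi'_form /tau_form /phi_form !(tnth_nth 0).
case: i => -[|[|[|[|[|//]]]]] ? /=; rewrite ?(tnth_nth 0) ?inordK //=.
all: rewrite !(piD, piN, pic, piP, piU).
all: rewrite /pi_p /pi_u !(tnth_nth 0) /=.
all: apply: linform_eq => [|k]; first by rewrite !(fstD, fstN, fstG); ring.
all: case: k => -[[|[|[|//]]] ?].
all: by rewrite !(coordD, coordN, coord_cst, coord_P, coord_U).
Qed.

End Proposition.

Lemma inj_surj_bij (A B : Type) (f : A -> B) :
  injective f -> (forall y, exists x, f x = y) -> bijective f.
Proof.
move=> f_inj f_surj; have [h hK] := choice f_surj.
by exists h => // x; apply: f_inj.
Qed.

(** * The adjoint action of the product and the final assembly *)

Section Assembly.
Variables (R : realType) (hbar : R[i]) (lam : 'I_3 -> R[i]).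
Hypothesis hbar_generic : forall n : nat, (0 < n)%N -> expC hbar ^+ n != 1.

Notation gen := (WA2_gens (@P R) (@U R)).

Lemma generic_hbar_neq0 : hbar != 0.
Proof. by apply: contra_neq (hbar_generic (ltn0Sn 0)) => ->; rewrite expC0 expr1n. Qed.

Lemma is_Ad_P123 (H : algType R[i]) (p u : 'I_3 -> H) (A : unitAlgType R[i])
    (ep eu : 'I_3 -> A) (piA : {lrmorphism A -> A}) :
    canonical_relations hbar p u -> exponential_map hbar (lin_exp hbar ep eu) ->
    determined_by ep eu ->
    (forall L, symplectomorphism L -> has_automorphism hbar ep eu L) ->
    realizes hbar ep eu (pi_form lam) piA ->
  forall f : A -> A, is_Ad hbar p u ep eu (P123 hbar lam p u) f <-> f =1 piA.
Proof.
move=> Hpu ee detA autA piA_pi.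
have hbar0 := generic_hbar_neq0.
have vP i : lin_val p u (P i) = p i by exact: (lin_val_gen p u (inl i)).
have vU i : lin_val p u (U i) = u i by exact: (lin_val_gen p u (inr i)).
have vUU i j : lin_val p u (U i - U j) = u i - u j by rewrite lin_valD lin_valN !vU.
have AdP (f : {lrmorphism A -> A}) : is_Ad hbar p u ep eu (P123 hbar lam p u) f <->
    realizes hbar ep eu (@swap_form R \o (@p1u_form R \o (lam_form lam \o id))) f.
  move: f.
  apply: (is_Ad_cons (L := @swap_form R) (M := @p1u_form R \o (lam_form lam \o id)) detA).
  - exact: (is_Ad_factor_Perm p u ee).
  - exact: autA (swap_symplectomorphism R).
  - apply: autA.
    exact: symplectomorphism_comp (p1u_symplectomorphism R) (lam_symplectomorphism lam).
  apply: (is_Ad_cons (L := @p1u_form R) (M := lam_form lam \o id) detA).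
  - apply: (is_Ad_factor_Exp ep eu Hpu hbar0) => l.
    by rewrite -vP -vUU; apply: exp_ad_quad (bracket_p1u R).
  - exact: autA (p1u_symplectomorphism R).
  - exact: autA (lam_symplectomorphism lam).
  apply: (is_Ad_cons (L := lam_form lam) (M := id) detA).
  - by apply: (is_Ad_factor_Exp ep eu Hpu hbar0) => l; rewrite -vUU; apply: exp_ad_shift.
  - exact: autA (lam_symplectomorphism lam).
  - by exists idfun; split; [exists id | move=> l].
  exact: is_Ad_nil detA.
have toPi (f : {lrmorphism A -> A}) :
    is_Ad hbar p u ep eu (P123 hbar lam p u) f <-> f =1 piA.
  rewrite AdP; split=> [f_real|fE l]; last by rewrite fE piA_pi -P123_form.
  by apply: (realizes_eq detA _ f_real piA_pi) => l; rewrite -P123_form.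
move=> f; split=> [Adf|fE]; last first.
  by apply: (is_Ad_ext (f := piA)) => //; apply/toPi.
(* A bare function [f] is first seen to agree with the morphism [g \o h], to which [toPi]
   applies. *)
have [g [h [_ _ _ fE]]] := Adf.
have gh : (g \o h : {lrmorphism A -> A}) =1 piA.
  by apply/toPi; apply: is_Ad_ext Adf.
by move=> x; rewrite fE -gh.
Qed.

End Assembly.

Theorem proposition3p1 (R : realType) (hbar : R[i]) (lam : 'I_3 -> R[i])
    (hbar_generic : forall n : nat, (0 < n)%N -> expC hbar ^+ n != 1)
    (H : algType R[i]) (p u : 'I_3 -> H)
    (Hpu : canonical_relations hbar p u)
    (W FracW : unitAlgType R[i]) (ep eu : 'I_3 -> W)
    (emb : {lrmorphism W -> FracW})
    (HW : is_WA2 hbar ep eu) (HFracW : skew_field_of_fractions emb)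
    (Y121 Y212 : unitAlgType R[i]) (Y : 'I_5 -> Y121) (Y' : 'I_5 -> Y212)
    (HY : is_skew_field_Y hbar (quiver_matrix 5 J121) Y)
    (HY' : is_skew_field_Y hbar (quiver_matrix 5 J212) Y') :
  let Fep := fun i => emb (ep i) in
  let Feu := fun i => emb (eu i) in
  exists (phi : {lrmorphism Y121 -> FracW}) (phi' : {lrmorphism Y212 -> FracW})
         (tau : {lrmorphism Y212 -> Y121})
         (piW : {lrmorphism W -> W}) (piF : {lrmorphism FracW -> FracW}),
    (morphism_given_by Y (phi_gens hbar lam Fep Feu) phi /\
     morphism_given_by Y' (phi'_gens hbar lam Fep Feu) phi') /\
    (morphism_given_by Y' (tau_gens hbar Y) tau /\ bijective tau) /\
    (morphism_given_by (WA2_gens ep eu) (pi_gens hbar lam ep eu) piW /\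
     bijective piW) /\
    (morphism_given_by (WA2_gens Fep Feu) (pi_gens hbar lam Fep Feu) piF /\
     bijective piF /\ forall w, piF (emb w) = emb (piW w)) /\
    (forall y, piF (phi' y) = phi (tau y)) /\
    (forall f : W -> W,
       is_Ad hbar p u ep eu (P123 hbar lam p u) f <-> f =1 piW) /\
    (forall f : FracW -> FracW,
       is_Ad hbar p u Fep Feu (P123 hbar lam p u) f <-> f =1 piF).
Proof.
move=> Fep Feu.
have eW := WA2_exponential_map HW; have eF := frac_WA2_exponential_map HW emb.
have detW := WA2_determined HW; have detF := frac_WA2_determined HW HFracW.
have autW := WA2_automorphism HW; have autF := frac_WA2_automorphism HW HFracW.
have skF : skew_field FracW by case: HFracW.
have skY := skew_field_Y_skew HY; have skY' := skew_field_Y_skew HY'.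
have [piW [piW_bij piW_comp]] := autW _ (P123_symplectomorphism lam).
have [piF [piF_bij piF_comp]] := autF _ (P123_symplectomorphism lam).
have piWE : realizes hbar ep eu (pi_form lam) piW.
  by move=> l; rewrite piW_comp P123_form.
have piFE : realizes hbar Fep Feu (pi_form lam) piF.
  by move=> l; rewrite piF_comp P123_form.
have [phi phiP] := skew_field_Y_form_lift hbar_generic HY skF eF
  (bracket_phi lam) (phi_free (lam := lam)).
have [phi' phi'P] := skew_field_Y_form_lift hbar_generic HY' skF eF
  (bracket_phi' lam) (phi'_free (lam := lam)).
have phi_inj := skew_field_morphism_inj (f := phi) skY.
have uY i : Y i \is a GRing.unit.
  apply: skY; apply/eqP => Y0; have := exponential_map_unit (phi_form lam i) eF.
  by have /= <- := phiP.1 i; rewrite Y0 rmorph0 unitr0.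
pose e2 := piF \o lin_exp hbar Fep Feu.
have e2E : exponential_map hbar e2 := exponential_map_rmorph piF eF.
have phi_tau i : phi (tau_gens hbar Y i) = e2 (phi'_form lam i).
  by rewrite (tau_gensE i eF uY phiP.1) /e2 /= piFE pi_phi'_form.
have [tau tauP] : exists tau : {lrmorphism Y212 -> Y121},
    morphism_given_by Y' (tau_gens hbar Y) tau.
  apply: (skew_field_Y_lift HY' skY).
    have rel := exponential_map_relations e2E (c := fun i j =>
      qpow hbar (2 * quiver_matrix 5 J212 i j)) (l := phi'_form lam).
    have {rel} [|_ relC] := rel.
      by move=> i j; rewrite qpow_quiver lin_bracketE bracket_phi'.
    split=> [i|i j]; last first.
      apply: phi_inj; rewrite [in RHS]linearZ !rmorphM /= !phi_tau; exact: relC.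
    have ui : tau_gens hbar Y i \is a GRing.unit.
      apply: skY; apply/eqP => t0; have := exponential_map_unit (phi'_form lam i) e2E.
      by rewrite -phi_tau t0 rmorph0 unitr0.
    by rewrite mulrV ?mulVr.
  move=> T x f presT fx.
  (* The separating units exist only in the target of [phi], so injectivity is shown for [phi \o f],
     whose values on generators are exponentials for [e2]. *)
  apply: (inj_compr (f := phi)).
  apply: (form_morphism_inj (f := phi \o f) hbar_generic presT _ e2E _
    (phi'_free (lam := lam))) => [i j|i]; first exact: expC_neq0.
  by rewrite /= fx phi_tau.
have tau_surj : forall y, exists z, tau z = y.
  have tauY (j : nat) : (j < 5)%N -> tau (Y' (inord j)) = tau_gens hbar Y (inord j).
    by move=> _; exact: tauP.1.
  have t0 := tauY 0 isT; have t1 := tauY 1 isT; have t2 := tauY 2 isT.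
  have t3 := tauY 3 isT; have t4 := tauY 4 isT.
  move: t0 t1 t2 t3 t4; rewrite /tau_gens !(tnth_nth 0) !inordK //= => t0 t1 t2 t3 t4.
  have uY' : Y' (inord 3) \is a GRing.unit.
    apply: skY'; apply/eqP => y0; have := uY (inord 3).
    by rewrite -unitrV -t3 y0 rmorph0 unitr0.
  have q0 : (expC hbar)^-1 != 0 by rewrite invr_eq0 expC_neq0.
  (* The vertex labelled 4 has index 3. Its generator in the source goes to the inverse of
     [Y (inord 3)], so multiplying by it and by [q] recovers [Y j]. *)
  have quot z j : tau z = (expC hbar)^-1 *: (Y j * Y (inord 3)) ->
      tau (expC hbar *: (z * Y' (inord 3))) = Y j.
    move=> tz; rewrite linearZ rmorphM /= tz t3 -scalerAl mulrK // scalerA.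
    by rewrite mulfV ?expC_neq0 // scale1r.
  apply: (skew_field_Y_surj HY skY') => i; rewrite -(inord_val i).
  case: i => -[|[|[|[|[|//]]]]] ? /=.
  - by exists (Y' (inord 0)).
  - by exists (expC hbar *: (Y' (inord 1) * Y' (inord 3))); apply: quot.
  - by exists (expC hbar *: (Y' (inord 2) * Y' (inord 3))); apply: quot.
  - by exists (Y' (inord 3))^-1; rewrite rmorphV //= t3 invrK.
  - by exists (Y' (inord 4)).
have phi_gens_eq : phi_gens hbar lam Fep Feu = lin_exp hbar Fep Feu \o phi_form lam.
  by apply/funext => i; apply: phi_gensE.
have phi'_gens_eq : phi'_gens hbar lam Fep Feu = lin_exp hbar Fep Feu \o phi'_form lam.
  by apply/funext => i; apply: phi'_gensE.
have piWg k : piW (WA2_gens ep eu k) = pi_gens hbar lam ep eu k.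
  by rewrite pi_gensE -(lin_exp_gen hbar) piWE.
have piFg k : piF (WA2_gens Fep Feu k) = pi_gens hbar lam Fep Feu k.
  by rewrite pi_gensE -(lin_exp_gen hbar) piFE.
exists phi, phi', tau, piW, piF; rewrite phi_gens_eq phi'_gens_eq.
split=> //; split; first split=> //.
  by apply: inj_surj_bij => //; apply: skew_field_morphism_inj.
split; first by split=> //; split=> // h hg; apply: detW => k; rewrite hg piWg.
split.
  split; first by split=> // h hg; apply: detF => k; rewrite hg piFg.
  split=> //; apply: (presented_eq HW (g := piF \o emb) (h := emb \o piW)) => k /=.
  rewrite -(lin_exp_gen hbar) piWE !(frac_WA2_lin_exp HW emb).
  exact: piFE.
split; first apply: (skew_field_Y_eq HY' (g := piF \o phi') (h := phi \o tau)) => i /=.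
  by rewrite tauP.1 phi_tau phi'P.1.
by split; apply: is_Ad_P123.
Qed.
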